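(* Let $\Lambda$ be a filtered ring such that $\mathrm{gr}\Lambda$ is a commutative Noetherian ${}^*$local ring with the condition (P). Let $M$ be a nonzero filtered (left) $\Lambda$-module with a good filtration for which $\mathrm{gr}M$ has finite Gorenstein dimension over $\mathrm{gr}\Lambda$ and $\text{G-dim}_\Lambda M=\text{G-dim}_{\mathrm{gr}\Lambda}\,\mathrm{gr}M$. Then $$\text{G-dim}_\Lambda M+{}^*\mathrm{depth}\,\mathrm{gr}M={}^*\mathrm{depth}\,\mathrm{gr}\Lambda .$$
   Context: A filtered ring is a ring $\Lambda$ with additive subgroups $\mathcal F_p\Lambda$ ($p\in\mathbb N=\{0,1,2,\dots\}$) such that $1\in\mathcal F_0\Lambda$, $\mathcal F_p\Lambda\subset\mathcal F_{p+1}\Lambda$, $(\mathcal F_p\Lambda)(\mathcal F_q\Lambda)\subset\mathcal F_{p+q}\Lambda$, $\Lambda=\bigcup_p\mathcal F_p\Lambda$; put $\mathcal F_p\Lambda=0$ for $p<0$ and $\mathrm{gr}\Lambda=\bigoplus_{p\ge 0}\mathcal F_p\Lambda/\mathcal F_{p-1}\Lambda$, a graded ring. When $\mathrm{gr}\Lambda$ is commutative Noetherian, $\Lambda$ is left and right Noetherian. A filtration of a $\Lambda$-module $M$ is a family of additive subgroups $\mathcal F_pM$ ($p\in\mathbb Z$) with $\mathcal F_pM\subset\mathcal F_{p+1}M$, $\mathcal F_{-p}M=0$ for $p\gg0$, $(\mathcal F_p\Lambda)(\mathcal F_qM)\subset\mathcal F_{p+q}M$, $M=\bigcup_p\mathcal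 F_pM$; put $\mathrm{gr}M=\bigoplus_{p\in\mathbb Z}\mathcal F_pM/\mathcal F_{p-1}M$. The filtration is good if there are $p_1,\dots,p_r\in\mathbb Z$, $m_1,\dots,m_r\in M$ with $\mathcal F_pM=\sum_{k=1}^r(\mathcal F_{p-p_k}\Lambda)m_k$ for all $p\in\mathbb Z$. A commutative Noetherian $\mathbb Z$-graded ring $R$ is ${}^*$local if it has a unique ${}^*$maximal ideal $\mathfrak m$, i.e. a unique maximal element among proper graded ideals. Condition (P): for every graded prime ideal $\mathfrak p\ne\mathfrak m$ there is an element of positive degree in $R-\mathfrak p$. For a finitely generated graded $R$-module $X$, ${}^*\mathrm{depth}X$ is the $\mathfrak m$-depth of $X$, i.e. the maximal length of an $X$-regular sequence in $\mathfrak m$. For a left and right Noetherian ring $\Gamma$ and a finitely generated $\Gamma$-module $X$, put $X^*=\mathrm{Hom}_\Gamma(X,\Gamma)$. $\text{G-dim}_\Gamma X=0$ means that the canonical map $X\to X^{**}$ is an isomorphism and $\mathrm{Ext}^k_\Gamma(X,\Gamma)=0=\mathrm{Ext}^k_{\Gamma^{\rm op}}(X^*,\Gamma)$ for all $k>0$. For $k>0$, $\text{G-dim}_\Gamma X\le k$ means there is an exact sequence $0\to G_k\to\cdots\to G_0\to X\to0$ of finitely generated modules with $\text{G-dim}\,G_i=0$ for all $i$. The Gorenstein dimension of $X$ is $\text{G-dim}_\Gamma X$, the least such $k$ ($\infty$ if none exists). *)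

(* Defs.v *)
From HB Require Import structures.
From mathcomp Require Import all_boot all_order all_algebra ring_quotient.
From mathcomp Require Import boolp classical_sets functions cardinality.
From mathcomp Require Import constructive_ereal.

Set Implicit Arguments.
Unset Strict Implicit.
Unset Printing Implicit Defensive.

Import Order.TTheory GRing.Theory Num.Theory.

Local Open Scope classical_set_scope.
Local Open Scope ring_scope.

Definition additive_subgroup (V : zmodType) (A : set V) : Prop :=
  A 0 /\ forall x y, A x -> A y -> A (x - y).

Record ring_filtration (L : nzRingType) := RingFiltration {
  rfil_nat : nat -> set L;
  rfil_subgroup : forall p, additive_subgroup (rfil_nat p);
  rfil_one : rfil_nat 0 1;
  rfil_incr : forall p, rfil_nat p `<=` rfil_nat p.+1;
  rfil_mul : forall p q a b,
    rfil_nat p a -> rfil_nat q b -> rfil_nat (p + q) (a * b);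
  rfil_exhaustive : forall a, exists p, rfil_nat p a }.

Definition rfil (L : nzRingType) (FL : ring_filtration L) (p : int) : set L :=
  if p is Posz n then rfil_nat FL n else [set 0].

Record mod_filtration (L : nzRingType) (FL : ring_filtration L)
    (M : lmodType L) := ModFiltration {
  mfil : int -> set M;
  mfil_subgroup : forall p, additive_subgroup (mfil p);
  mfil_incr : forall p, mfil p `<=` mfil (p + 1);
  mfil_bounded : exists N : nat, forall p : nat, (N <= p)%N ->
    mfil (- p%:Z) = [set 0];
  mfil_scale : forall p q a x,
    rfil FL p a -> mfil q x -> mfil (p + q) (a *: x);
  mfil_exhaustive : forall x, exists p, mfil p x }.

Definition good_filtration (L : nzRingType) (FL : ring_filtration L)
    (M : lmodType L) (FM : mod_filtration FL M) : Prop :=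
  exists (r : nat) (pk : 'I_r -> int) (mk : 'I_r -> M),
    forall p : int, mfil FM p =
      [set x | exists2 a : 'I_r -> L, forall k, rfil FL (p - pk k) (a k) &
                 x = \sum_(k < r) a k *: mk k].

(* The associated graded ring is the quotient of the direct sum of the F_p     *)
(* by the direct sum of the F_(p-1). The direct sum of the F_p, with its       *)
(* graded product, is realised as the Rees subring of {poly L}: polynomials    *)
(* whose coefficient of degree p lies in F_p.                                  *)
Section AssociatedGradedRing.
Variables (L : nzRingType) (FL : ring_filtration L).

Lemma rfil0 p : rfil FL p 0.
Proof. by case: p => [n|n] //=; case: (rfil_subgroup FL n). Qed.

Lemma rfilB p x y : rfil FL p x -> rfil FL p y -> rfil FL p (x - y).
Proof.
case: p => [n|n] /=; first by case: (rfil_subgroup FL n) => _; apply.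
by move=> -> ->; rewrite subr0.
Qed.

Lemma rfilD p x y : rfil FL p x -> rfil FL p y -> rfil FL p (x + y).
Proof.
move=> xp yp; rewrite -[y]opprK; apply: rfilB => //.
by rewrite -[- y]sub0r; apply: rfilB => //; exact: rfil0.
Qed.

Lemma rfilM p q x y : rfil FL p x -> rfil FL q y -> rfil FL (p + q) (x * y).
Proof.
case: p => [n|n]; last by move=> /= ->; rewrite mul0r => _; exact: rfil0.
case: q => [k|k]; last by move=> _ /= ->; rewrite mulr0; exact: rfil0.
exact: rfil_mul.
Qed.

Lemma rfil_pred p x : rfil FL (p - 1) x -> rfil FL p x.
Proof.
case: p => [[|n]|n]; last by [].
  by move=> xE; rewrite (xE : x = 0); exact: rfil0.
by rewrite intS addrC addKr; exact: rfil_incr.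
Qed.

Lemma rfil_sum p (I : Type) (r : seq I) (P : pred I) (E : I -> L) :
  (forall i, P i -> rfil FL p (E i)) -> rfil FL p (\sum_(i <- r | P i) E i).
Proof. by move=> EP; apply: big_ind => //; [exact: rfil0|exact: rfilD]. Qed.

Definition rees_pred : {pred {poly L}} :=
  fun a => `[< forall p : nat, rfil FL p a`_p >].

Fact rees_subring : subring_closed rees_pred.
Proof.
split=> [|a b /asboolP aR /asboolP bR|a b /asboolP aR /asboolP bR];
    apply/asboolP => p.
- rewrite coef1; case: p => [|p]; first exact: rfil_one.
  by rewrite mulr0n; exact: rfil0.
- by rewrite coefB; apply: rfilB.
- rewrite coefM; apply: rfil_sum => i _.
  have -> : p%:Z = (i : nat)%:Z + (p - i)%:Z.
    by rewrite -PoszD subnKC // -ltnS ltn_ord.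
  exact: rfilM.
Qed.
HB.instance Definition _ := GRing.isSubringClosed.Build {poly L} rees_pred
  rees_subring.

Definition rees := {a : {poly L} | rees_pred a}.
HB.instance Definition _ := SubChoice.on rees.
HB.instance Definition _ := [SubChoice_isSubNzRing of rees by <:].

Definition rees_ideal : {pred rees} :=
  fun a => `[< forall p : nat, rfil FL (p%:Z - 1) (val a)`_p >].

Fact rees_ideal_zmod : zmod_closed rees_ideal.
Proof.
split=> [|a b /asboolP aI /asboolP bI]; apply/asboolP => p.
  by rewrite raddf0 coef0; exact: rfil0.
by rewrite raddfB coefB; apply: rfilB.
Qed.
HB.instance Definition _ := GRing.isZmodClosed.Build rees rees_ideal
  rees_ideal_zmod.

Lemma reesP (a : rees) (p : nat) : rfil FL p (val a)`_p.
Proof. by move: p; apply/asboolP; exact: (valP a). Qed.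

Lemma rees_idealMl a b : b \in rees_ideal -> a * b \in rees_ideal.
Proof.
move=> /asboolP bI; apply/asboolP => p.
rewrite rmorphM coefM; apply: rfil_sum => i _.
have -> : p%:Z - 1 = (i : nat)%:Z + ((p - i)%:Z - 1).
  by rewrite addrA -PoszD subnKC // -ltnS ltn_ord.
by apply: rfilM => //; exact: reesP.
Qed.

Lemma rees_idealMr a b : a \in rees_ideal -> a * b \in rees_ideal.
Proof.
move=> /asboolP aI; apply/asboolP => p.
rewrite rmorphM coefM; apply: rfil_sum => i _.
have -> : p%:Z - 1 = ((i : nat)%:Z - 1) + (p - i)%:Z.
  by rewrite addrAC -PoszD subnKC // -ltnS ltn_ord.
by apply: rfilM => //; exact: reesP.
Qed.

Definition gr := {ideal_quot rees_ideal}.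
HB.instance Definition _ := GRing.Zmodule.on gr.

Definition gr_class (a : rees) : gr := \pi_({ideal_quot rees_ideal})%qT a.

Lemma gr_class_eq a b : (gr_class a == gr_class b) = (a - b \in rees_ideal).
Proof. by rewrite Quotient.idealrBE. Qed.

Lemma gr_classB : {morph gr_class : a b / a - b}.
Proof. exact: (raddfB (\pi_({ideal_quot rees_ideal}))%qT). Qed.

Lemma gr_classD : {morph gr_class : a b / a + b}.
Proof. exact: (raddfD (\pi_({ideal_quot rees_ideal}))%qT). Qed.

Lemma gr_class_repr x : gr_class (repr x) = x.
Proof. exact: reprK. Qed.

Lemma gr_repr_class a : repr (gr_class a) - a \in rees_ideal.
Proof. by rewrite -gr_class_eq gr_class_repr. Qed.

Definition gr_one : gr := gr_class 1.
Definition gr_mul (x y : gr) : gr := gr_class (repr x * repr y).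

Lemma gr_mulE a b : gr_mul (gr_class a) (gr_class b) = gr_class (a * b).
Proof.
apply/eqP; rewrite gr_class_eq.
set a' := repr _; set b' := repr _.
have -> : a' * b' - a * b = a' * (b' - b) + (a' - a) * b.
  by rewrite mulrBr mulrBl addrA subrK.
apply: rpredD; [apply: rees_idealMl|apply: rees_idealMr]; exact: gr_repr_class.
Qed.

Fact gr_mulA : associative gr_mul.
Proof.
move=> x y z; rewrite -[x]gr_class_repr -[y]gr_class_repr -[z]gr_class_repr.
by rewrite !gr_mulE mulrA.
Qed.
Fact gr_mul1l : left_id gr_one gr_mul.
Proof. by move=> x; rewrite -[x]gr_class_repr gr_mulE mul1r. Qed.
Fact gr_mul1r : right_id gr_one gr_mul.
Proof. by move=> x; rewrite -[x]gr_class_repr gr_mulE mulr1. Qed.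
Fact gr_mulDl : left_distributive gr_mul +%R.
Proof.
move=> x y z; rewrite -[x]gr_class_repr -[y]gr_class_repr -[z]gr_class_repr.
by rewrite -gr_classD !gr_mulE mulrDl gr_classD.
Qed.
Fact gr_mulDr : right_distributive gr_mul +%R.
Proof.
move=> x y z; rewrite -[x]gr_class_repr -[y]gr_class_repr -[z]gr_class_repr.
by rewrite -gr_classD !gr_mulE mulrDr gr_classD.
Qed.
Fact gr_one_neq0 : gr_one != 0.
Proof.
have -> : 0 = gr_class 0 by rewrite -[in RHS](subrr 0) gr_classB subrr.
rewrite gr_class_eq subr0; apply/asboolP => /(_ 0%N) /=.
by rewrite coef1 => /eqP; rewrite oner_eq0.
Qed.

HB.instance Definition _ := GRing.Zmodule_isNzRing.Build gr
  gr_mulA gr_mul1l gr_mul1r gr_mulDl gr_mulDr gr_one_neq0.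

Definition gr_homog (p : int) : set gr :=
  [set gr_class a | a in [set a : rees | forall i : nat,
                                         i%:Z != p -> (val a)`_i = 0]].

End AssociatedGradedRing.

Arguments gr_homog {L} FL p.

(* Likewise gr M is the quotient of the direct sum of the F_p M, realised as    *)
(* finitely supported maps u : int -> M with u p in F_p M, by the direct sum   *)
(* of the F_(p-1) M. Homogeneous components act by                             *)
(* (a mod F_(i-1)) (x mod F_(q-1)) = a x mod F_(i+q-1).                        *)
Section AssociatedGradedModule.
Variables (L : nzRingType) (FL : ring_filtration L).
Variables (M : lmodType L) (FM : mod_filtration FL M).

Lemma mfil0 p : mfil FM p 0.
Proof. by case: (mfil_subgroup FM p). Qed.

Lemma mfilB p x y : mfil FM p x -> mfil FM p y -> mfil FM p (x - y).
Proof. by case: (mfil_subgroup FM p) => _; apply. Qed.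

Lemma mfilD p x y : mfil FM p x -> mfil FM p y -> mfil FM p (x + y).
Proof.
move=> xp yp; rewrite -[y]opprK; apply: mfilB => //.
by rewrite -[- y]sub0r; apply: mfilB => //; exact: mfil0.
Qed.

Lemma mfil_sum p (I : Type) (r : seq I) (P : pred I) (E : I -> M) :
  (forall i, P i -> mfil FM p (E i)) -> mfil FM p (\sum_(i <- r | P i) E i).
Proof. by move=> EP; apply: big_ind => //; [exact: mfil0|exact: mfilD]. Qed.

Definition mrees_pred : {pred int -> M} := fun u =>
  `[< finite_set [set p | u p != 0] /\ forall p, mfil FM p (u p) >].

Fact mrees_zmod : zmod_closed mrees_pred.
Proof.
split=> [|u v /asboolP[uS uM] /asboolP[vS vM]]; apply/asboolP.
  split=> [|p]; last exact: mfil0.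
  by apply: (sub_finite_set _ (finite_set0 _)) => p /=; rewrite eqxx.
split=> [|p]; last by apply: mfilB.
apply: (@sub_finite_set _ _ ([set p | u p != 0] `|` [set p | v p != 0])).
  move=> p /= uvp; have [up|up] := eqVneq (u p) 0; last by left.
  by right; move: uvp; rewrite fctE up sub0r oppr_eq0.
by rewrite finite_setU.
Qed.
HB.instance Definition _ := GRing.isZmodClosed.Build (int -> M) mrees_pred
  mrees_zmod.

Definition mrees := {u : int -> M | mrees_pred u}.
HB.instance Definition _ := SubChoice.on mrees.
HB.instance Definition _ := [SubChoice_isSubZmodule of mrees by <:].

Definition mrees_sub : {pred mrees} :=
  fun u => `[< forall p, mfil FM (p - 1) (val u p) >].

Fact mrees_sub_zmod : zmod_closed mrees_sub.
Proof.
split=> [|u v /asboolP uI /asboolP vI]; apply/asboolP => p /=.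
  exact: mfil0.
exact: mfilB.
Qed.
HB.instance Definition _ := GRing.isZmodClosed.Build mrees mrees_sub
  mrees_sub_zmod.

Definition mrees_act_fun (a : {poly L}) (u : int -> M) (p : int) : M :=
  \sum_(i < size a) a`_i *: u (p - (i : nat)%:Z).

Lemma mrees_act_widen (n : nat) (a : {poly L}) (u : int -> M) (p : int) :
  (size a <= n)%N ->
  mrees_act_fun a u p = \sum_(i < n) a`_i *: u (p - (i : nat)%:Z).
Proof.
move=> an; rewrite /mrees_act_fun.
rewrite -(big_mkord xpredT (fun i => a`_i *: u (p - i%:Z))).
rewrite -[RHS](big_mkord xpredT (fun i => a`_i *: u (p - i%:Z))).
rewrite [RHS](big_cat_nat (n := size a)) //= [X in _ = _ + X]big_nat_cond.
rewrite [X in _ = _ + X]big1 ?addr0 // => i /andP[/andP[ai _] _].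
by rewrite nth_default // scale0r.
Qed.

Lemma mrees_act_funD (a b : {poly L}) u p :
  mrees_act_fun (a + b) u p = mrees_act_fun a u p + mrees_act_fun b u p.
Proof.
pose n := maxn (size a) (size b).
rewrite !(@mrees_act_widen n) ?leq_maxl ?leq_maxr ?size_polyD //.
by rewrite -big_split /=; apply: eq_bigr => i _; rewrite coefD scalerDl.
Qed.

Lemma mrees_act_funCM c (b : {poly L}) u p :
  mrees_act_fun (c%:P * b) u p = c *: mrees_act_fun b u p.
Proof.
rewrite mul_polyC (@mrees_act_widen (size b)) ?size_scale_leq // scaler_sumr.
by apply: eq_bigr => i _; rewrite coefZ scalerA.
Qed.

Lemma mrees_act_funMX (a : {poly L}) u p :
  mrees_act_fun (a * 'X) u p = mrees_act_fun a u (p - 1).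
Proof.
rewrite (@mrees_act_widen (size a).+1); last first.
  by apply: leq_trans (size_polyMleq _ _) _; rewrite size_polyX addn2.
rewrite big_ord_recl coefMX /= scale0r add0r; apply: eq_bigr => i _.
by rewrite coefMX /= /bump /= add1n intS opprD addrA.
Qed.

Lemma mrees_act_funM (a b : {poly L}) u p :
  mrees_act_fun a (mrees_act_fun b u) p = mrees_act_fun (a * b) u p.
Proof.
elim/poly_ind: a p => [|a c IH] p.
  by rewrite mul0r /mrees_act_fun size_poly0 !big_ord0.
rewrite mulrDl !mrees_act_funD mrees_act_funMX IH -mulrA -commr_polyX mulrA.
rewrite mrees_act_funMX mrees_act_funCM; congr (_ + _).
by rewrite -[c%:P]mulr1 mrees_act_funCM (@mrees_act_widen 1) ?size_poly1 //
  big_ord1 coef1 /= subr0 scale1r.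
Qed.

Fact mrees_act_subproof (a : rees FL) (u : mrees) :
  mrees_pred (mrees_act_fun (val a) (val u)).
Proof.
have /asboolP[uS uM] := valP u; apply/asboolP; split=> [|p].
  apply: (@sub_finite_set _ _
    [set i%:Z + q | i in `I_(size (val a)) & q in [set q | val u q != 0]]).
    move=> p /= ap; apply: contrapT => nap; move/eqP: ap; apply.
    apply: big1 => i _; apply/eqP; apply: contraT => aup; exfalso; apply: nap.
    exists (i : nat); first exact: ltn_ord.
    exists (p - (i : nat)%:Z); last by rewrite addrC subrK.
    by apply/eqP => up; move: aup; rewrite up scaler0 eqxx.
  by apply: finite_image2.
apply: mfil_sum => i _.
have -> : p = (i : nat)%:Z + (p - (i : nat)%:Z) by rewrite addrC subrK.
by rewrite [X in val u X]addrC addKr; apply: mfil_scale;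
  [exact: reesP|exact: uM].
Qed.

Definition mrees_act (a : rees FL) (u : mrees) : mrees :=
  Sub (mrees_act_fun (val a) (val u)) (mrees_act_subproof a u).

Lemma mreesP (u : mrees) p : mfil FM p (val u p).
Proof. by have /asboolP[_] := valP u; apply. Qed.

Lemma mrees_act1 u : mrees_act 1 u = u.
Proof.
apply: val_inj; apply/funext => p.
rewrite [LHS](@mrees_act_widen 1) ?size_poly1 //.
by rewrite big_ord1 coef1 /= subr0 scale1r.
Qed.

Lemma mrees_actDr a : {morph mrees_act a : u v / u + v}.
Proof.
move=> u v; apply: val_inj; apply/funext => p.
rewrite /= /mrees_act_fun /= !fctE -big_split /=.
by apply: eq_bigr => i _; rewrite scalerDr.
Qed.

Lemma mrees_actDl u : {morph mrees_act^~ u : a b / a + b}.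
Proof.
move=> a b; apply: val_inj; apply/funext => p.
by rewrite /= fctE; exact: mrees_act_funD.
Qed.

Lemma mrees_actA a b u : mrees_act a (mrees_act b u) = mrees_act (a * b) u.
Proof.
by apply: val_inj; apply/funext => p; exact: mrees_act_funM.
Qed.

Lemma mrees_act_sub a u : u \in mrees_sub -> mrees_act a u \in mrees_sub.
Proof.
move=> /asboolP uI; apply/asboolP => p; apply: mfil_sum => i _.
have -> : p - 1 = (i : nat)%:Z + (p - (i : nat)%:Z - 1).
  by rewrite addrA [X in _ = X - 1]addrC subrK.
by apply: mfil_scale; first exact: reesP.
Qed.

Lemma mrees_act_ideal a u : a \in @rees_ideal L FL -> mrees_act a u \in mrees_sub.
Proof.
move=> /asboolP aI; apply/asboolP => p; apply: mfil_sum => i _.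
have -> : p - 1 = ((i : nat)%:Z - 1) + (p - (i : nat)%:Z).
  by rewrite addrAC [X in _ = X - 1]addrC subrK.
by apply: mfil_scale => //; exact: mreesP.
Qed.

Definition grm := {ideal_quot mrees_sub}.
HB.instance Definition _ := GRing.Zmodule.on grm.

Definition grm_class (u : mrees) : grm := \pi_({ideal_quot mrees_sub})%qT u.

Lemma grm_class_eq u v : (grm_class u == grm_class v) = (u - v \in mrees_sub).
Proof. by rewrite Quotient.idealrBE. Qed.

Lemma grm_classD : {morph grm_class : u v / u + v}.
Proof. exact: (raddfD (\pi_({ideal_quot mrees_sub}))%qT). Qed.

Lemma grm_class_repr x : grm_class (repr x) = x.
Proof. exact: reprK. Qed.

Lemma grm_repr_class u : repr (grm_class u) - u \in mrees_sub.
Proof. by rewrite -grm_class_eq grm_class_repr. Qed.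

Definition grm_scale (x : gr FL) (u : grm) : grm :=
  grm_class (mrees_act (repr x) (repr u)).

Lemma grm_scaleE a u :
  grm_scale (gr_class a) (grm_class u) = grm_class (mrees_act a u).
Proof.
apply/eqP; rewrite grm_class_eq.
set a' := repr _; set u' := repr _.
have -> : mrees_act a' u' - mrees_act a u =
    mrees_act a' (u' - u) + mrees_act (a' - a) u.
  rewrite -[in LHS](subrK u u') mrees_actDr -addrA; congr (_ + _).
  by rewrite -[in LHS](subrK a a') mrees_actDl addrK.
apply: rpredD; [apply: mrees_act_sub|apply: mrees_act_ideal].
  exact: grm_repr_class.
exact: gr_repr_class.
Qed.

Fact grm_scaleA x y u : grm_scale x (grm_scale y u) = grm_scale (x * y) u.
Proof.
rewrite -[x]gr_class_repr -[y]gr_class_repr -[u]grm_class_repr.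
by rewrite [_ * _]gr_mulE !grm_scaleE mrees_actA.
Qed.
Fact grm_scale1 : left_id 1 grm_scale.
Proof.
by move=> u; rewrite -[u]grm_class_repr [1]/(gr_class 1) grm_scaleE mrees_act1.
Qed.
Fact grm_scaleDr : right_distributive grm_scale +%R.
Proof.
move=> x u v.
rewrite -[x]gr_class_repr -[u]grm_class_repr -[v]grm_class_repr.
by rewrite -grm_classD !grm_scaleE mrees_actDr grm_classD.
Qed.
Fact grm_scaleDl u : {morph grm_scale^~ u : x y / x + y}.
Proof.
move=> x y.
rewrite -[x]gr_class_repr -[y]gr_class_repr -[u]grm_class_repr.
by rewrite -gr_classD !grm_scaleE mrees_actDl grm_classD.
Qed.

HB.instance Definition _ := GRing.Zmodule_isLmodule.Build (gr FL) grm
  grm_scaleA grm_scale1 grm_scaleDr grm_scaleDl.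

End AssociatedGradedModule.

(* The left R-linear maps X -> R form a right R-module, i.e. a left module     *)
(* over the opposite ring R^c, under (a *: f) x = f x * a.                     *)
Definition dual (R : pzRingType) (X : lmodType R) : Type := {linear X -> R^o}.

Section DualModule.
Variables (R : pzRingType) (X : lmodType R).
Notation D := (dual X).

HB.instance Definition _ := gen_eqMixin D.
HB.instance Definition _ := gen_choiceMixin D.

Definition dual_app (f : D) (x : X) : R := (f : {linear X -> R^o}) x.

Lemma dualP (f g : D) : (forall x, dual_app f x = dual_app g x) -> f = g.
Proof.
move: f g => [f cf] [g cg] fg; have {fg} E : f = g by apply/funext.
case: _ / E cg => cg; congr GRing.Linear.Pack.
case: cf cg => [[a] [b]] [[c] [d]].
by rewrite (Prop_irrelevance a c) (Prop_irrelevance b d).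
Qed.

Definition dual_zero : D := \0 : {linear X -> R^o}.
Definition dual_add (f g : D) : D :=
  (f : {linear X -> R^o}) \+ (g : {linear X -> R^o}).
Definition dual_opp (f : D) : D := \- (f : {linear X -> R^o}).
Definition dual_scale_fun (a : R) (f : D) : X -> R^o :=
  fun x => dual_app f x * a.
Fact dual_scale_linear a f : linear (dual_scale_fun a f).
Proof.
move=> b x y; rewrite /dual_scale_fun /dual_app linearP mulrDl.
by rewrite /= -[b *: _]/(b * _) -mulrA.
Qed.
HB.instance Definition _ a f := GRing.isLinear.Build R X R^o _ (dual_scale_fun a f) (dual_scale_linear a f).
Definition dual_scale (a : R^c) (f : D) : D := dual_scale_fun a f : {linear X -> R^o}.

Fact dual_addA : associative dual_add.
Proof. by move=> f g h; apply: dualP => x; exact: addrA. Qed.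
Fact dual_addC : commutative dual_add.
Proof. by move=> f g; apply: dualP => x; exact: addrC. Qed.
Fact dual_add0 : left_id dual_zero dual_add.
Proof. by move=> f; apply: dualP => x; exact: add0r. Qed.
Fact dual_addN : left_inverse dual_zero dual_opp dual_add.
Proof. by move=> f; apply: dualP => x; exact: addNr. Qed.
HB.instance Definition _ := GRing.isZmodule.Build D
  dual_addA dual_addC dual_add0 dual_addN.

Fact dual_scaleA a b f : dual_scale a (dual_scale b f) = dual_scale (a * b) f.
Proof. by apply: dualP => x; apply: esym; exact: (@mulrA R). Qed.
Fact dual_scale1 : left_id 1 dual_scale.
Proof. by move=> f; apply: dualP => x; exact: (@mulr1 R). Qed.
Fact dual_scaleDr : right_distributive dual_scale +%R.
Proof. by move=> a f g; apply: dualP => x; exact: (@mulrDl R). Qed.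
Fact dual_scaleDl f : {morph dual_scale^~ f : a b / a + b}.
Proof. by move=> a b; apply: dualP => x; exact: (@mulrDr R). Qed.
HB.instance Definition _ := GRing.Zmodule_isLmodule.Build R^c D
  dual_scaleA dual_scale1 dual_scaleDr dual_scaleDl.

End DualModule.

Section Evaluation.
Variables (R : pzRingType) (X : lmodType R).

Definition eval_fun (x : X) : dual X -> (R^c)^o := fun f => dual_app f x.
Fact eval_linear x : linear (eval_fun x).
Proof. by move=> a f g. Qed.
HB.instance Definition _ x := GRing.isLinear.Build R^c (dual X) (R^c)^o _
  (eval_fun x) (eval_linear x).

(* The canonical map X -> X^** is automatically R-linear, since                *)
(* eval_fun (a *: x) f = a * eval_fun x f, so it is an isomorphism exactly     *)
(* when it is bijective.                                                       *)
Definition bidual_map (x : X) : dual (dual X) := eval_fun x : {linear _ -> _}.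
End Evaluation.


Definition fin_gen (R : pzRingType) (X : lmodType R) : Prop :=
  exists (n : nat) (v : 'I_n -> X),
    forall x, exists c : 'I_n -> R, x = \sum_(i < n) c i *: v i.

Definition projective (R : pzRingType) (P : lmodType R) : Prop :=
  forall (A B : lmodType R) (p : {linear A -> B}) (f : {linear P -> B}),
    (forall b, exists a, p a = b) ->
    exists g : {linear P -> A}, forall x, p (g x) = f x.

(* An exact sequence ... -> C_1 -> C_0 -> X -> 0.                              *)
Record resolution (R : pzRingType) (X : lmodType R) := Resolution {
  res_mod :> nat -> lmodType R;
  res_diff : forall i, {linear res_mod i.+1 -> res_mod i};
  res_aug : {linear res_mod 0%N -> X};
  res_aug_surj : forall x, exists y, res_aug y = x;
  res_exact0 : forall y,
    res_aug y = 0 <-> exists z, res_diff 0%N z = y;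
  res_exactS : forall i y,
    res_diff i y = 0 <-> exists z, res_diff i.+1 z = y }.

(* Ext^k_R(X, Y) = 0: the complex Hom_R(P, Y) has no cohomology in degree k,   *)
(* for P a projective resolution of X. Such P always exist (e.g. free ones)    *)
(* and the cohomology does not depend on the choice of P.                      *)
Definition Ext_zero (R : pzRingType) (k : nat) (X Y : lmodType R) : Prop :=
  forall P : resolution X, (forall i, projective (P i)) ->
  forall f : {linear P k -> Y}, (forall z, f (res_diff P k z) = 0) ->
    match k return {linear P k -> Y} -> Prop with
    | 0%N => fun f => forall y, f y = 0
    | i.+1 => fun f => exists g : {linear P i -> Y},
                         forall y, f y = g (res_diff P i y)
    end f.

Definition Gdim_zero (R : pzRingType) (X : lmodType R) : Prop :=
  [/\ fin_gen X,
      bijective (@bidual_map R X),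
      forall k, (0 < k)%N -> Ext_zero k X R^o &
      forall k, (0 < k)%N -> Ext_zero k (dual X) (R^c)^o].

(* For k > 0 the exact sequence 0 -> C_k -> ... -> C_0 -> X -> 0 is encoded as *)
(* a resolution with C_i = 0 for i > k.                                        *)
Definition Gdim_le (R : pzRingType) (X : lmodType R) (k : nat) : Prop :=
  if k is 0%N then Gdim_zero X else
  exists C : resolution X,
    (forall i, (i <= k)%N -> Gdim_zero (C i)) /\
    (forall i, (k < i)%N -> forall y : C i, y = 0).

Definition Gdim (R : pzRingType) (X : lmodType R) : \bar nat :=
  xget +oo%E [set k%:E | k in
    [set k : nat | Gdim_le X k /\ forall j, Gdim_le X j -> (k <= j)%N]]%E.

(* From here on R is commutative in all uses, so left ideals are ideals.       *)
Section GradedRings.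
Variables (R : pzRingType) (homog : int -> set R).

Definition ideal (I : set R) : Prop :=
  [/\ I 0, forall x y, I x -> I y -> I (x + y) & forall a x, I x -> I (a * x)].

Definition noetherian : Prop :=
  forall I, ideal I -> exists s : seq R,
    I = [set x | exists c : nat -> R, x = \sum_(i < size s) c i * s`_i].

Definition graded_ideal (I : set R) : Prop :=
  ideal I /\ forall x, I x -> exists s : seq R,
    (forall y, y \in s -> I y /\ exists p, homog p y) /\ x = \sum_(y <- s) y.

Definition prime_ideal (I : set R) : Prop :=
  [/\ ideal I, ~ I 1 & forall x y, I (x * y) -> I x \/ I y].

Definition star_maximal (I : set R) : Prop :=
  [/\ graded_ideal I, ~ I 1 &
      forall J, graded_ideal J -> ~ J 1 -> I `<=` J -> J = I].

(* R is *local with unique *maximal ideal m. *)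
Definition star_local (m : set R) : Prop :=
  star_maximal m /\ forall n, star_maximal n -> n = m.

Definition condition_P (m : set R) : Prop :=
  forall p, graded_ideal p -> prime_ideal p -> p <> m ->
    exists (d : int) (x : R), [/\ 0 < d, homog d x & ~ p x].

End GradedRings.

Section Depth.
Variables (R : pzRingType) (X : lmodType R).

(* seq_span s is the submodule (s_0, ..., s_(n-1))X. *)
Definition seq_span (s : seq R) : set X :=
  [set x | exists v : nat -> X, x = \sum_(i < size s) s`_i *: v i].

Definition regular_seq (s : seq R) : Prop :=
  (forall i, (i < size s)%N -> forall x,
     seq_span (take i s) (s`_i *: x) -> seq_span (take i s) x) /\
  exists x, ~ seq_span s x.

(* +oo when the lengths are unbounded or when no sequence is regular (X = 0).  *)
Definition depth (m : set R) : \bar nat :=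
  xget +oo%E [set n%:E | n in
    [set n : nat |
      (exists s, [/\ regular_seq s, forall a, a \in s -> m a & size s = n]) /\
      forall s, regular_seq s -> (forall a, a \in s -> m a) ->
        (size s <= n)%N]]%E.

End Depth.

(* Main.v *)
(** Write R = gr Lambda and X = gr M. As Gdim M = Gdim X by hypothesis, the
    claim is the Auslander-Bridger formula for X. Since R is concentrated in
    nonnegative degrees, m contains all elements of positive degree and is a
    maximal ideal of the ring R; depth is read off from the vanishing of
    Ext^i(R/m, -).

    If G-dim G = 0 and s is an R-regular sequence, then G/sG = Hom(G^*, R/sR)
    because Ext^i(G^*, R) = 0 for i > 0. Hence s is G-regular, and a copy of
    R/m in R/sR yields one in G/sG as soon as G^* does not vanish at m; so
    depth G = depth R. For 0 -> K -> G -> X -> 0 with G and K of G-dimension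
    0 and Ext^1(X, R)_m nonzero, the same identification gives a nonzero
    element of K/sK that vanishes in G/sG, so s cannot be X-regular and
    depth X = depth R - 1. Longer G-resolutions follow by dimension shifting,
    starting from Ext^n(X, R)_m nonzero. If n = G-dim X > 0, this holds because
    Ext^n(X, R) is nonzero and graded: the annihilator of a nonzero homogeneous
    class is a proper graded ideal, hence contained in m. *)

From HB Require Import structures.
From mathcomp Require Import all_boot all_order all_algebra ring_quotient.
From mathcomp Require Import boolp classical_sets functions cardinality.
From mathcomp Require Import constructive_ereal.
Require Import Defs.

Set Implicit Arguments.
Unset Strict Implicit.
Unset Printing Implicit Defensive.

Import Order.TTheory GRing.Theory Num.Theory.

Local Open Scope classical_set_scope.
Local Open Scope ring_scope.

(** * Linear maps, quotients and cohomology of Hom(P, -) *)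

(** [Ext_zero] quantifies over all projective resolutions: its vanishing may be used on whichever
    one is convenient, but proving it for a new module means treating an arbitrary one. Two choices
    avoid comparing resolutions. A short exact sequence is handled through an explicit horseshoe
    resolution of its middle term, built from arbitrary resolutions of the ends. Non-vanishing is
    stated, as failure of [coh_zero] or [coh_torsion], relative to a named resolution: [P] of R/m
    for depth, and ultimately one by homogeneous matrices for Ext(X, R).

    Localisation at m is never formed. Vanishing at m means being killed by an element outside m,
    and Nakayama's lemma is replaced by [residue_functional_exists], which produces a nonzero
    functional with values in a copy of R/m. Duals are left modules over [R^c], so several facts are
    transported along commutativity. *)

Section LinearMaps.
Variable R : pzRingType.
Implicit Types U V W A B C X : lmodType R.

Definition mklin U V (f : U -> V) (f_lin : linear f) : {linear U -> V} :=
  HB.pack f (GRing.isLinear.Build R U V _ f f_lin).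

Lemma lin_factor U A B (i : {linear A -> B}) (f : {linear U -> B}) :
  injective i -> (forall u, exists a, i a = f u) ->
  exists g : {linear U -> A}, forall u, i (g u) = f u.
Proof.
move=> i_inj fP; pose g u := projT1 (cid (fP u)).
have gP u : i (g u) = f u by exact: projT2 (cid (fP u)).
have g_lin : linear g by move=> a x y; apply: i_inj; rewrite linearP !gP linearP.
by exists (mklin g_lin).
Qed.

Lemma lin_descend U V W (p : {linear U -> V}) (f : {linear U -> W}) :
  (forall v, exists u, p u = v) -> (forall u, p u = 0 -> f u = 0) ->
  exists g : {linear V -> W}, forall u, g (p u) = f u.
Proof.
move=> p_surj pf; pose s v := projT1 (cid (p_surj v)).
have sP v : p (s v) = v by exact: projT2 (cid (p_surj v)).
have sE u v : p u = v -> f (s v) = f u.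
  move=> <-; apply/eqP; rewrite -subr_eq0 -linearB; apply/eqP; apply: pf.
  by rewrite linearB sP subrr.
have g_lin : linear (f \o s).
  by move=> a x y /=; rewrite -linearP; apply: sE; rewrite linearP !sP.
by exists (mklin g_lin) => u; exact: sE.
Qed.

Definition submodule X (N : set X) :=
  [/\ N 0, forall x y, N x -> N y -> N (x + y) & forall a x, N x -> N (a *: x)].

Lemma submoduleN X (N : set X) x : submodule N -> N x -> N (- x).
Proof. by case=> _ _ NZ /(NZ (-1)); rewrite scaleN1r. Qed.

Lemma submoduleB X (N : set X) x y : submodule N -> N x -> N y -> N (x - y).
Proof. by move=> Nsub Nx Ny; case: (Nsub) => _ ND _; apply: ND => //; exact: submoduleN. Qed.

Lemma submodule_sum X (N : set X) I (r : seq I) (F : I -> X) :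
  submodule N -> (forall i, N (F i)) -> N (\sum_(i <- r) F i).
Proof. by move=> [N0 ND _] NF; apply: big_ind => // i _; exact: NF. Qed.

Definition short_exact A B C (i : {linear A -> B}) (p : {linear B -> C}) :=
  [/\ injective i, forall c, exists b, p b = c
    & forall b, p b = 0 <-> exists a, i a = b].

End LinearMaps.

Section QuotientModule.
Variables (R : pzRingType) (X : lmodType R) (N : set X) (Nsub : submodule N).

Definition quo_pred : {pred X} := fun x => `[< N x >].

Fact quo_pred_zmod : zmod_closed quo_pred.
Proof.
split=> [|x y /asboolP Nx /asboolP Ny]; apply/asboolP; first by case: Nsub.
exact: submoduleB.
Qed.
HB.instance Definition _ := GRing.isZmodClosed.Build X quo_pred quo_pred_zmod.

Definition quo := {ideal_quot quo_pred}.
HB.instance Definition _ := GRing.Zmodule.on quo.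

Definition quo_class (x : X) : quo := \pi_({ideal_quot quo_pred})%qT x.

Lemma quo_class_eq x y : quo_class x = quo_class y <-> N (x - y).
Proof.
have -> : N (x - y) <-> (x - y \in quo_pred) by split=> /asboolP.
by rewrite Quotient.idealrBE; split=> /eqP.
Qed.

Lemma quo_classD : {morph quo_class : x y / x + y}.
Proof. exact: (raddfD (\pi_({ideal_quot quo_pred}))%qT). Qed.

Lemma quo_class_repr x : quo_class (repr x) = x.
Proof. exact: reprK. Qed.

Definition quo_scale a (u : quo) : quo := quo_class (a *: repr u).

Lemma quo_scaleE a x : quo_scale a (quo_class x) = quo_class (a *: x).
Proof.
apply/quo_class_eq; rewrite -scalerBr; case: (Nsub) => _ _; apply.
by apply/quo_class_eq; exact: quo_class_repr.
Qed.

Fact quo_scaleA a b u : quo_scale a (quo_scale b u) = quo_scale (a * b) u.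
Proof. by rewrite -[u]quo_class_repr !quo_scaleE scalerA. Qed.
Fact quo_scale1 : left_id 1 quo_scale.
Proof. by move=> u; rewrite -[u]quo_class_repr quo_scaleE scale1r. Qed.
Fact quo_scaleDr : right_distributive quo_scale +%R.
Proof.
move=> a u v; rewrite -[u]quo_class_repr -[v]quo_class_repr.
by rewrite -quo_classD !quo_scaleE scalerDr quo_classD.
Qed.
Fact quo_scaleDl u : {morph quo_scale^~ u : a b / a + b}.
Proof.
by move=> a b; rewrite -[u]quo_class_repr !quo_scaleE scalerDl quo_classD.
Qed.
HB.instance Definition _ := GRing.Zmodule_isLmodule.Build R quo
  quo_scaleA quo_scale1 quo_scaleDr quo_scaleDl.

Fact quo_class_linear : linear quo_class.
Proof. by move=> a x y; rewrite quo_classD -quo_scaleE. Qed.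

(** Only surjectivity and the kernel are kept, so that later statements can take any surjection with
    the prescribed kernel as the quotient. *)
Lemma quotient_exists :
  exists (Q : lmodType R) (p : {linear X -> Q}),
    (forall q, exists x, p x = q) /\ (forall x, p x = 0 <-> N x).
Proof.
exists quo, (mklin quo_class_linear); split=> [q|x].
  by exists (repr q); exact: quo_class_repr.
have E := quo_class_eq x 0; rewrite subr0 in E.
by rewrite -(linear0 (mklin quo_class_linear)); exact: E.
Qed.

End QuotientModule.

Section LongExactSequence.
Variables (R : pzRingType) (X : lmodType R) (P : resolution X).
Hypothesis Pproj : forall i, projective (P i).
Implicit Types A B C Y : lmodType R.

(* [Ext_zero k X Y] unfolds to [coh_zero k Y] for every projective [P]. *)
Definition coh_zero k Y := forall f : {linear P k -> Y},
  (forall z, f (res_diff P k z) = 0) ->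
  match k return {linear P k -> Y} -> Prop with
  | 0%N => fun f => forall y, f y = 0
  | i.+1 => fun f => exists g : {linear P i -> Y},
                       forall y, f y = g (res_diff P i y)
  end f.

Lemma res_dd i z : res_diff P i (res_diff P i.+1 z) = 0.
Proof. by apply/res_exactS; exists z. Qed.

Lemma res_aug_d z : res_aug P (res_diff P 0%N z) = 0.
Proof. by apply/res_exact0; exists z. Qed.

(** Exactness of H^k(B), H^k(C), H^(k+1)(A) in the middle: a cocycle with values in C lifts to B
    since P_k is projective, and the coboundary of the lift comes from A. *)
Lemma coh_zero_quo k A B C (i : {linear A -> B}) (p : {linear B -> C}) :
  short_exact i p -> coh_zero k B -> coh_zero k.+1 A -> coh_zero k C.
Proof.
move=> [i_inj p_surj ip] HB HA f fd.
have [f' f'E] := Pproj f p_surj.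
have [|x xE] := @lin_factor _ _ _ _ i (f' \o res_diff P k)%FUN i_inj.
  by move=> u; apply/ip; rewrite /= f'E.
have [z|w wE] := HA x.
  by apply: i_inj; rewrite xE linear0 /= res_dd linear0.
(* The corrected lift differs from [f'] by a map into A, so it still covers [f], and it is a
   cocycle. *)
have E : linear (fun y => f' y - i (w y)).
  by move=> a u v; rewrite !linearP scalerDr addrACA.
have dE z : mklin E (res_diff P k z) = 0 by rewrite /= -wE xE subrr.
have pi a : p (i a) = 0 by apply/ip; exists a.
case: k => [|k] in f fd f' f'E HB HA x xE w wE E dE *.
  move=> y; have /= := HB (mklin E) dE y.
  by move/(congr1 p); rewrite linearB linear0 pi subr0 f'E.
have [g gE] := HB (mklin E) dE; exists (p \o g)%FUN => y /=.
by rewrite -gE /= linearB pi subr0 f'E.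
Qed.

(** Stated for one cocycle [f], because in [coh_zero_lift] its image in B is a coboundary for a
    reason other than the vanishing of H^(k+1)(B). Vanishing of H^k(C) lets [g] be changed, without
    changing its coboundary, into a map with values in the image of A. *)
Lemma coh_zero_sub k A B C (i : {linear A -> B}) (p : {linear B -> C})
    (f : {linear P k.+1 -> A}) (g : {linear P k -> B}) :
  short_exact i p -> coh_zero k C ->
  (forall z, i (f z) = g (res_diff P k z)) ->
  exists h : {linear P k -> A}, forall z, f z = h (res_diff P k z).
Proof.
move=> [i_inj p_surj ip] HC fg.
have pgd z : (p \o g)%FUN (res_diff P k z) = 0.
  by rewrite /= -fg; apply/ip; exists (f z).
have [g' [g'd pg']] : exists g' : {linear P k -> B},
    (forall z, g' (res_diff P k z) = g (res_diff P k z)) /\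
    forall z, p (g' z) = 0.
  case: k => [|k] in f g fg HC pgd *; first by exists g; split=> //; exact: (HC (p \o g)%FUN pgd).
  have [h hE] := HC (p \o g)%FUN pgd.
  have [h' h'E] := Pproj h p_surj.
  have E : linear (fun y => g y - h' (res_diff P k y)).
    by move=> a u v; rewrite !linearP scalerDr addrACA.
  exists (mklin E); split=> z /=; first by rewrite res_dd linear0 subr0.
  by rewrite linearB h'E -hE subrr.
have [|h hE] := @lin_factor _ _ _ _ _ g' i_inj; first by move=> u; apply/ip.
by exists h => z; apply: i_inj; rewrite fg hE g'd.
Qed.

Lemma coh_zero_subS k A B C (i : {linear A -> B}) (p : {linear B -> C}) :
  short_exact i p -> coh_zero k C -> coh_zero k.+1 B -> coh_zero k.+1 A.
Proof.
move=> E HC HB f fd; have [z|g gE] := HB (i \o f)%FUN; first by rewrite /= fd linear0.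
exact: coh_zero_sub E HC gE.
Qed.

(** Applied to R and X, this yields one sequence that is regular on both. *)
Lemma coh_zero_pair k A B : coh_zero k A -> coh_zero k B -> coh_zero k (A * B)%type.
Proof.
move=> HA HB f fd.
have E1 : linear (fun y => (f y).1) by move=> a u v; rewrite linearP.
have E2 : linear (fun y => (f y).2) by move=> a u v; rewrite linearP.
have d1 z : mklin E1 (res_diff P k z) = 0 by rewrite /= fd.
have d2 z : mklin E2 (res_diff P k z) = 0 by rewrite /= fd.
case: k => [|k] in f fd HA HB E1 E2 d1 d2 *.
  move=> y; move: (HA _ d1 y) (HB _ d2 y) => /=.
  by case: (f y) => /= ? ? -> ->.
have [g gE] := HA _ d1; have [h hE] := HB _ d2.
have E : linear (fun y => (g y, h y)) by move=> a u v; rewrite !linearP.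
by exists (mklin E) => y /=; rewrite -gE -hE /=; case: (f y).
Qed.

End LongExactSequence.

(** * Dimension shifting in the first variable *)

Section Projective.
Variable R : pzRingType.
Implicit Types A B C X Y : lmodType R.

Lemma ker_submodule A B (f : {linear A -> B}) : submodule [set x | f x = 0].
Proof.
split=> [|x y /= fx fy|a x /= fx] /=; first exact: linear0.
  by rewrite linearD fx fy addr0.
by rewrite linearZ /= fx scaler0.
Qed.

Lemma range_submodule A B (f : {linear A -> B}) : submodule [set y | exists x, f x = y].
Proof.
split=> [|_ _ /= [x <-] [y <-]|a _ /= [x <-]]; first by exists 0; exact: linear0.
  by exists (x + y); exact: linearD.
by exists (a *: x); exact: linearZ.
Qed.

(** [projective] only lifts along surjections. Here [d] need only cover the image of [f], so it is
    replaced by the quotient by its kernel followed by an embedding. *)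
Lemma projective_lift (P : lmodType R) B C (d : {linear B -> C}) (f : {linear P -> C}) :
  projective P -> (forall y, exists b, d b = f y) ->
  exists g : {linear P -> B}, forall y, d (g y) = f y.
Proof.
move=> Pproj fP.
have [Q [p [p_surj pE]]] := quotient_exists (ker_submodule d).
have [u|e eE] := lin_descend (f := d) p_surj; first by move/pE.
have e_inj : injective e.
  move=> x y exy; have [u uE] := p_surj (x - y).
  apply/eqP; rewrite -subr_eq0 -uE; apply/eqP/pE => /=.
  by rewrite -eE uE linearB exy subrr.
have [y|f' f'E] := @lin_factor _ _ _ _ e f e_inj.
  by have [b bE] := fP y; exists (p b); rewrite eE.
have [g gE] := Pproj _ _ _ f' p_surj.
by exists g => y; rewrite -eE gE.
Qed.

Lemma projective_pair (P Q : lmodType R) :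
  projective P -> projective Q -> projective (P * Q)%type.
Proof.
move=> HP HQ A B p f p_surj.
have E1 : linear (fun x : P => f (x, 0)).
  move=> a x y; rewrite -linearP; congr (f _).
  by apply/pair_equal_spec; split=> //=; rewrite scaler0 addr0.
have E2 : linear (fun x : Q => f (0, x)).
  move=> a x y; rewrite -linearP; congr (f _).
  by apply/pair_equal_spec; split=> //=; rewrite scaler0 addr0.
have [g1 g1E] := HP _ _ p (mklin E1) p_surj.
have [g2 g2E] := HQ _ _ p (mklin E2) p_surj.
have E : linear (fun x : P * Q => g1 x.1 + g2 x.2).
  by move=> a x y; rewrite !linearP scalerDr addrACA.
exists (mklin E) => -[x y] /=; rewrite linearD g1E g2E /= -linearD; congr (f _).
by apply/pair_equal_spec; split=> /=; rewrite ?addr0 ?add0r.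
Qed.

End Projective.

Section Homotopy.
Variables (R : pzRingType) (mulC : forall x y : R, x * y = y * x).
Variables (X : lmodType R) (P : resolution X).
Hypothesis Pproj : forall i, projective (P i).

Lemma scale_linear (Y : lmodType R) (a : R) : linear (fun y : Y => a *: y).
Proof. by move=> b x y; rewrite scalerDr !scalerA mulC. Qed.

(** Multiplication by [a] is null-homotopic on P; on boundaries one of the two terms of the homotopy
    vanishes, and the remaining identity is all that is kept. *)
Lemma ann_homotopy (a : R) (k : nat) : (forall x : X, a *: x = 0) ->
  exists h : {linear P k -> P k.+1}, forall z : P k.+1,
    res_diff P k (h (res_diff P k z)) = a *: res_diff P k z.
Proof.
move=> aX; elim: k => [|k [h hE]].
  have [y|h hE] := projective_lift (d := res_diff P 0%N)
      (f := mklin (@scale_linear (P 0%N) a)) (@Pproj 0).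
    by apply/res_exact0; rewrite /= linearZ /= aX.
  by exists h => z; rewrite hE.
have E : linear (fun y : P k.+1 => a *: y - h (res_diff P k y)).
  by move=> b x y; rewrite scale_linear !linearP scalerDr addrACA.
have [y|h' h'E] := projective_lift (d := res_diff P k.+1) (f := mklin E) (@Pproj k.+1).
  by apply/res_exactS; rewrite /= linearB linearZ /= hE subrr.
by exists h' => z; rewrite h'E /= res_dd linear0 subr0.
Qed.

(** Hence [a] annihilates the cohomology in positive degrees: [a *: z] minus [h] of the differential
    of [z] is a cycle, so a boundary, on which [f] vanishes. *)
Lemma ann_coh (a : R) (k : nat) (Y : lmodType R) (f : {linear P k.+1 -> Y}) :
  (forall x : X, a *: x = 0) -> (forall z, f (res_diff P k.+1 z) = 0) ->
  exists g : {linear P k -> Y}, forall z, a *: f z = g (res_diff P k z).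
Proof.
move=> aX fd; have [h hE] := ann_homotopy k aX.
exists (f \o h)%FUN => z /=.
have [w wE] : exists w, res_diff P k.+1 w = a *: z - h (res_diff P k z).
  by apply/res_exactS; rewrite linearB linearZ /= hE subrr.
apply/eqP; rewrite -subr_eq0 -linearZ -linearB /= -wE; apply/eqP; exact: fd.
Qed.

End Homotopy.

Section Horseshoe.
Variables (R : pzRingType) (mulC : forall x y : R, x * y = y * x).
Variables (A B C : lmodType R) (i : {linear A -> B}) (p : {linear B -> C}).
Hypothesis ip : short_exact i p.
Variables (P : resolution A) (Q : resolution C).
Hypotheses (Pproj : forall k, projective (P k)) (Qproj : forall k, projective (Q k)).

(** [e] and [t] are the off-diagonal part of a resolution P + Q of B with differential (x, q) to (d
    x + t q, d q). Having them explicitly turns the connecting maps below into composition with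
    [t]. *)
Lemma horseshoe_data : exists (e : {linear Q 0%N -> B})
    (t : forall k, {linear Q k.+1 -> P k}),
  [/\ forall q, p (e q) = res_aug Q q,
      forall q, i (res_aug P (t 0%N q)) = - e (res_diff Q 0%N q)
    & forall k q, res_diff P k (t k.+1 q) = - t k (res_diff Q k.+1 q)].
Proof.
case: ip => i_inj p_surj ipE.
have [e eE] := Qproj (res_aug Q) p_surj.
have [q|a aE] := @lin_factor _ _ _ _ i (\- (e \o res_diff Q 0%N))%R i_inj.
  by apply/ipE; rewrite /= linearN eE res_aug_d oppr0.
have [q|t0 t0E] := projective_lift (d := res_aug P) (f := a) (@Qproj 1%N).
  exact: res_aug_surj.
have t0d q : res_aug P (t0 (res_diff Q 1%N q)) = 0.
  by apply: i_inj; rewrite linear0 t0E aE /= res_dd linear0 oppr0.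
(* This invariant keeps the recursion going: the next [t] lifts minus [t] after the differential of
   Q, so that map must take values in boundaries of P. *)
pose bnd k (t : {linear Q k.+1 -> P k}) :=
  forall q, exists z, res_diff P k z = t (res_diff Q k.+1 q).
have step k (t : {t | bnd k t}) : {u : {t' | bnd k.+1 t'} |
    forall q, res_diff P k (sval u q) = - sval t (res_diff Q k.+1 q)}.
  apply: cid; case: t => t tP /=.
  have [q|u uE] := projective_lift (d := res_diff P k)
      (f := (\- (t \o res_diff Q k.+1))%R) (@Qproj k.+2).
    by have [z zE] := tP q; exists (- z); rewrite linearN zE.
  have uP : bnd k.+1 u.
    by move=> q; apply/res_exactS; rewrite uE /= res_dd linear0 oppr0.
  by exists (exist _ u uP).
have b0 : bnd 0%N t0 by move=> q; apply/res_exact0.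
pose T := nat_rect (fun k => {t | bnd k t}) (exist _ t0 b0)
  (fun k t => sval (step k t)).
exists e, (fun k => sval (T k)); split=> // [q|k q].
  by rewrite /= t0E aE.
exact: (svalP (step k (T k))).
Qed.

Section Resolution.
Variables (e : {linear Q 0%N -> B}) (t : forall k, {linear Q k.+1 -> P k}).
Hypotheses (pe : forall q, p (e q) = res_aug Q q)
  (it : forall q, i (res_aug P (t 0%N q)) = - e (res_diff Q 0%N q))
  (dt : forall k q, res_diff P k (t k.+1 q) = - t k (res_diff Q k.+1 q)).

Fact hs_diff_linear k : linear (fun x : P k.+1 * Q k.+1 =>
  (res_diff P k x.1 + t k x.2, res_diff Q k x.2) : P k * Q k).
Proof.
move=> a x y; rewrite !linearP; apply/pair_equal_spec; split=> //=.
by rewrite scalerDr addrACA.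
Qed.

Fact hs_aug_linear : linear (fun x : P 0%N * Q 0%N => i (res_aug P x.1) + e x.2).
Proof. by move=> a x y; rewrite !linearP scalerDr addrACA. Qed.

Fact hs_aug_surj b : exists y, mklin hs_aug_linear y = b.
Proof.
case: ip => i_inj p_surj ipE.
have [q qE] := res_aug_surj Q (p b).
have /ipE[a aE] : p (b - e q) = 0 by rewrite linearB pe qE subrr.
have [x xE] := res_aug_surj P a.
by exists (x, q); rewrite /= xE aE subrK.
Qed.

Fact hs_exact0 y : mklin hs_aug_linear y = 0 <->
  exists z, mklin (@hs_diff_linear 0%N) z = y.
Proof.
case: ip => i_inj p_surj ipE; case: y => x q; split=> [/= xq|[[x' q'] [<- <-]]] /=.
  have pi : p (i (res_aug P x)) = 0 by apply/ipE; exists (res_aug P x).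
  have /res_exact0[q' q'E] : res_aug Q q = 0.
    by rewrite -pe -[LHS]add0r -pi -linearD xq linear0.
  have /res_exact0[x' x'E] : res_aug P (x - t 0%N q') = 0.
    by apply: i_inj; rewrite !linearB /= it opprK q'E linear0.
  by exists (x', q'); rewrite /= x'E q'E subrK.
by rewrite linearD res_aug_d add0r it addNr.
Qed.

Fact hs_exactS k y : mklin (@hs_diff_linear k) y = 0 <->
  exists z, mklin (@hs_diff_linear k.+1) z = y.
Proof.
case: y => x q; split=> [/= [xq dq]|[[x' q'] [<- <-]]] /=.
  have /res_exactS[q' q'E] := dq.
  have /res_exactS[x' x'E] : res_diff P k (x - t k.+1 q') = 0.
    by rewrite linearB dt opprK q'E.
  by exists (x', q'); rewrite /= x'E q'E subrK.
by rewrite linearD !res_dd add0r dt addNr.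
Qed.

Definition horseshoe : resolution B :=
  Resolution hs_aug_surj hs_exact0 hs_exactS.

Lemma horseshoe_projective k : projective (horseshoe k).
Proof. exact: projective_pair. Qed.

End Resolution.

Implicit Type Y : lmodType R.

(* For S the complement of a prime m, this is the vanishing of Ext^(k+1)(X, Y)_m. *)
Definition coh_torsion (S : set R) (X : lmodType R) (P : resolution X) k Y :=
  forall f : {linear P k.+1 -> Y}, (forall z, f (res_diff P k.+1 z) = 0) ->
  exists2 a, S a & exists g : {linear P k -> Y}, forall y, a *: f y = g (res_diff P k y).

(** The connecting map sends [f] to [f] composed with [t]. If that is the coboundary of [h], then
    (x, q) to f x - h q is a cocycle on the horseshoe extending [f]. *)
Lemma Ext_zero_left k Y : Ext_zero k.+1 B Y -> coh_zero Q k.+2 Y -> coh_zero P k.+1 Y.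
Proof.
have [e [t [pe it dt]]] := horseshoe_data => HB HQ f fd.
have [q|h hE] := HQ (f \o t k.+1)%FUN.
  rewrite /= -[t _ _]opprK -dt linearN.
  by have := fd (t k.+2 q); rewrite /= => ->; rewrite oppr0.
have F_lin : linear (fun x : P k.+1 * Q k.+1 => f x.1 - h x.2).
  by move=> a x y; rewrite !linearP scalerDr addrACA.
have [[x q]|g gE] := HB (horseshoe pe it dt) (@horseshoe_projective e t pe it dt) (mklin F_lin).
  by rewrite /= linearD [f (res_diff _ _ _)]fd add0r -hE /= subrr.
have G_lin : linear (fun x : P k => g (x, 0)).
  move=> a x y; rewrite -linearP; congr (g _).
  by apply/pair_equal_spec; split=> //=; rewrite scaler0 addr0.
exists (mklin G_lin) => y; have /= := gE (y, 0).
by rewrite !linear0 !addr0.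
Qed.

(** On the horseshoe [f] becomes the coboundary of some [g]. The restriction of [g] to P is a
    cocycle whose composite with [t] represents the class of [f], so an element of [S] that makes it
    a coboundary does the same for [f]. Taking [S] = {1} gives ordinary vanishing. *)
Lemma Ext_torsion_right (S : set R) k Y : Ext_zero k.+2 B Y -> coh_torsion S P k Y ->
  coh_torsion S Q k.+1 Y.
Proof.
have [e [t [pe it dt]]] := horseshoe_data => HB HP f fd.
have F_lin : linear (fun x : P k.+2 * Q k.+2 => f x.2).
  by move=> a x y; rewrite !linearP.
have [[x q]|g gE] := HB (horseshoe pe it dt) (@horseshoe_projective e t pe it dt) (mklin F_lin).
  exact: fd.
have G1_lin : linear (fun x : P k.+1 => g (x, 0)).
  move=> a x y; rewrite -linearP; congr (g _).
  by apply/pair_equal_spec; split=> //=; rewrite scaler0 addr0.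
have G2_lin : linear (fun x : Q k.+1 => g (0, x)).
  move=> a x y; rewrite -linearP; congr (g _).
  by apply/pair_equal_spec; split=> //=; rewrite scaler0 addr0.
have gS x q : g (x, q) = mklin G1_lin x + mklin G2_lin q.
  rewrite /= -linearD; congr (g _).
  by apply/pair_equal_spec; split=> /=; rewrite ?addr0 ?add0r.
have [x|a Sa [h hE]] := HP (mklin G1_lin).
  by have /= := gE (x, 0); rewrite !linear0 addr0.
exists a => //.
have H_lin : linear (fun q : Q k.+1 =>
    mklin (@scale_linear _ mulC Y a) (mklin G2_lin q) - h (t k q)).
  by move=> b x y; rewrite !linearP scalerDr addrACA.
exists (mklin H_lin) => q; have /= := gE (0, q).
rewrite linear0 add0r gS => ->; rewrite scalerDr hE /= addrC; congr (_ + _).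
by rewrite -linearN; congr (h _); rewrite dt.
Qed.

(** Lowest degree of the same sequence: Hom(A, Y) takes the place of the Ext group of A, and being a
    coboundary is replaced by extending to B. *)
Lemma Ext_torsion_right0 (S : set R) Y : Ext_zero 1 B Y ->
  (forall f : {linear A -> Y}, exists2 a, S a &
     exists g : {linear B -> Y}, forall x, a *: f x = g (i x)) ->
  coh_torsion S Q 0 Y.
Proof.
have [e [t [pe it dt]]] := horseshoe_data => HB HA f fd.
have F_lin : linear (fun x : P 1%N * Q 1%N => f x.2).
  by move=> a x y; rewrite !linearP.
have [[x q]|g gE] := HB (horseshoe pe it dt) (@horseshoe_projective e t pe it dt) (mklin F_lin).
  exact: fd.
have G1_lin : linear (fun x : P 0%N => g (x, 0)).
  move=> a x y; rewrite -linearP; congr (g _).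
  by apply/pair_equal_spec; split=> //=; rewrite scaler0 addr0.
have G2_lin : linear (fun x : Q 0%N => g (0, x)).
  move=> a x y; rewrite -linearP; congr (g _).
  by apply/pair_equal_spec; split=> //=; rewrite scaler0 addr0.
have gS x q : g (x, q) = mklin G1_lin x + mklin G2_lin q.
  rewrite /= -linearD; congr (g _).
  by apply/pair_equal_spec; split=> /=; rewrite ?addr0 ?add0r.
have [x|f' f'E] := lin_descend (f := mklin G1_lin) (res_aug_surj P).
  by move=> /res_exact0[z <-]; have /= := gE (z, 0); rewrite !linear0 addr0.
have [a Sa [h hE]] := HA f'; exists a => //.
have H_lin : linear (fun q : Q 0%N => mklin (@scale_linear _ mulC Y a) (mklin G2_lin q) - h (e q)).
  by move=> b x y; rewrite !linearP scalerDr addrACA.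
exists (mklin H_lin) => q; have /= := gE (0, q).
rewrite linear0 add0r gS => ->; rewrite scalerDr -f'E hE it /= addrC; congr (_ + _).
exact: linearN.
Qed.

(** The obstruction to extending [f] is its image [F] in Ext^1(C, Y). If [F] is the coboundary of
    [h], then (x, q) to f (aug x) - h q descends from the horseshoe to B. *)
Lemma coh_extend Y : coh_zero Q 1 Y -> forall f : {linear A -> Y},
  exists g : {linear B -> Y}, forall x, g (i x) = f x.
Proof.
case: ip => i_inj p_surj ipE HQ f.
have [e [t [pe it dt]]] := horseshoe_data.
pose F := (f \o (res_aug P \o t 0%N))%FUN.
have [q|h hE] := HQ F.
  by rewrite /F /= -[t _ _]opprK -dt linearN /= res_aug_d oppr0 linear0.
have H_lin : linear (fun x : P 0%N * Q 0%N => f (res_aug P x.1) - h x.2).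
  by move=> a x y; rewrite !linearP scalerDr addrACA.
have [x|g gE] := lin_descend (f := mklin H_lin) (hs_aug_surj pe).
  move/(hs_exact0 pe it) => [[z q] <-].
  by rewrite /= !linearD res_aug_d linear0 add0r -hE /= subrr.
exists g => x; have [y yE] := res_aug_surj P x.
have /= := gE (y, 0); rewrite !linear0 !addr0 yE; exact.
Qed.

End Horseshoe.

(** * Free resolutions over a Noetherian ring *)

Section FreeModules.
Variable R : pzRingType.
Implicit Types (X Y : lmodType R) (n r : nat).

Definition comb X n (x : 'I_n -> X) (v : 'rV[R]_n) : X := \sum_(i < n) v 0 i *: x i.

Fact comb_linear X n (x : 'I_n -> X) : linear (comb x).
Proof.
move=> a u v; rewrite /comb scaler_sumr -big_split; apply: eq_bigr => i _ /=.
by rewrite !mxE scalerDl scalerA.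
Qed.

Lemma comb_delta X n (x : 'I_n -> X) i : comb x (delta_mx 0 i) = x i.
Proof.
rewrite /comb (bigD1 i) //= mxE !eqxx scale1r big1 ?addr0 // => j ji.
by rewrite mxE eqxx (negbTE ji) scale0r.
Qed.

Lemma linear_comb X n (f : {linear 'rV[R]_n -> X}) v :
  f v = comb (fun i => f (delta_mx 0 i)) v.
Proof.
rewrite [in LHS](row_sum_delta v) linear_sum; apply: eq_bigr => i _.
exact: linearZ.
Qed.

Lemma rV_projective n : projective ('rV[R]_n : lmodType R).
Proof.
move=> A B p f p_surj; have [g gE] := choice (fun i => p_surj (f (delta_mx 0 i))).
exists (mklin (comb_linear g)) => v; rewrite [RHS]linear_comb linear_sum.
by apply: eq_bigr => i _; rewrite linearZ /= gE.
Qed.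

Lemma fin_genP X : fin_gen X <->
  exists n (x : 'I_n -> X), forall y, exists v, comb x v = y.
Proof.
split=> -[n [x xX]]; exists n, x => y.
  have [c ->] := xX y; exists (\row_i c i).
  by apply: eq_bigr => i _; rewrite mxE.
by have [v <-] := xX y; exists (fun i => v 0 i).
Qed.

Lemma fin_gen_regular : fin_gen R^o.
Proof.
exists 1%N, (fun=> 1) => a; exists (fun=> a); rewrite big_ord1.
exact/esym/(mulr1 (a : R)).
Qed.

Lemma fin_gen_surj X Y (p : {linear X -> Y}) :
  (forall y, exists x, p x = y) -> fin_gen X -> fin_gen Y.
Proof.
move=> p_surj [n [x xX]]; exists n, (p \o x) => y.
have [z <-] := p_surj y; have [c ->] := xX z; exists c.
by rewrite linear_sum; apply: eq_bigr => i _; rewrite linearZ.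
Qed.

Lemma comb_mul X n r (x : 'I_n -> X) (A : 'M[R]_(r, n)) w :
  comb x (w *m A) = comb (fun i => comb x (row i A)) w.
Proof.
have /= -> := linear_comb (mklin (comb_linear x) \o mulmxr A)%FUN w.
by apply: eq_bigr => i _; rewrite /= rowE.
Qed.

Lemma nth_lincomb (s : seq R) i : (i < size s)%N ->
  exists c : nat -> R, s`_i = \sum_(j < size s) c j * s`_j.
Proof.
move=> is_; exists (fun j => (j == i)%:R).
rewrite (bigD1 (Ordinal is_)) //= eqxx mul1r big1 ?addr0 // => j /eqP ji.
by case: eqP => [ji'|_]; [case: ji; exact: val_inj|rewrite mul0r].
Qed.

Hypothesis noeR : noetherian R.

(** The first coordinates of N form an ideal; subtracting a combination of vectors that lift its
    generators leaves a vector with first coordinate zero, which the induction hypothesis covers. *)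
Lemma noetherian_submodule n (N : set 'rV[R]_n) : submodule N ->
  exists r (A : 'M[R]_(r, n)), forall v, N v <-> exists w, v = w *m A.
Proof.
elim: n N => [|n IH] N Nsub.
  exists 0%N, 0 => v; rewrite (thinmx0 v); split=> _; last by case: Nsub.
  by exists 0; rewrite mul0mx.
case: (Nsub) => N0 ND NZ.
have [|s sE] := noeR (I := [set c | exists2 v : 'rV_(1 + n), N v & v 0 0 = c]).
  split=> [|_ _ [u Nu <-] [v Nv <-]|a _ [u Nu <-]].
  - by exists 0; rewrite ?mxE.
  - by exists (u + v); [exact: ND|rewrite mxE].
  - by exists (a *: u); [exact: NZ|rewrite mxE].
have sN i : (i < size s)%N -> exists v : 'rV_(1 + n), N v /\ v 0 0 = s`_i.
  move=> is_; have [v Nv vi] : [set c | exists2 v : 'rV_(1 + n), N v & v 0 0 = c] s`_i.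
    by rewrite sE; exact: nth_lincomb.
  by exists v.
have [u uE] := choice (fun i : 'I_(size s) => sN i (ltn_ord i)).
have [|r [A AE]] := IH [set w : 'rV_n | N (row_mx (0 : 'rV_1) w)].
  split=> [|x y /= Nx Ny|a x /= Nx] /=; first by rewrite row_mx0.
    have -> : row_mx (0 : 'rV_1) (x + y) = row_mx 0 x + row_mx 0 y.
      by rewrite add_row_mx addr0.
    exact: ND.
  have -> : row_mx (0 : 'rV_1) (a *: x) = a *: row_mx 0 x.
    by rewrite scale_row_mx scaler0.
  exact: NZ.
pose U : 'M[R]_(size s, 1 + n) := \matrix_i u i.
have NU w : N (w *m U).
  rewrite mulmx_sum_row; apply: submodule_sum => // i; apply: NZ.
  by rewrite rowK; case: (uE i).
have NA w : N (w *m row_mx (0 : 'M_(r, 1)) A).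
  by rewrite mul_mx_row mulmx0; apply/AE; exists w.
exists (size s + r)%N, (col_mx U (row_mx 0 A)) => v; split=> [Nv|[w ->]]; last first.
  by rewrite -[w]hsubmxK mul_row_col; apply: ND.
have : [set c | exists2 v : 'rV_(1 + n), N v & v 0 0 = c] (v 0 0) by exists v.
rewrite sE => -[c cE]; pose w1 : 'rV_(size s) := \row_i c i.
pose z : 'rV_(1 + n) := v - w1 *m U.
have z0 : lsubmx z = 0.
  apply/matrixP => i j; rewrite !ord1 !mxE.
  have -> : lshift n (0 : 'I_1) = 0 by exact: val_inj.
  rewrite cE; apply/eqP; rewrite subr_eq0; apply/eqP; apply: eq_bigr => k _.
  by rewrite !mxE; have [_ ->] := uE k.
have [|w2 w2E] := (AE (rsubmx z)).1.
  by rewrite /= -z0 hsubmxK; apply: submoduleB.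
exists (row_mx w1 w2); rewrite mul_row_col.
have -> : w2 *m row_mx (0 : 'M_(r, 1)) A = z.
  by rewrite mul_mx_row mulmx0 -w2E -z0 hsubmxK.
by rewrite /z addrC subrK.
Qed.

Lemma fin_gen_submodule X Y (i : {linear X -> Y}) :
  injective i -> fin_gen Y -> fin_gen X.
Proof.
move=> i_inj /fin_genP[n [y yY]].
have [|r [A AE]] := @noetherian_submodule n [set v | exists x, i x = comb y v].
  split=> [|u v /= [x xE] [x' xE']|a v /= [x xE]].
  - by exists 0; rewrite linear0; exact/esym/(linear0 (mklin (comb_linear y))).
  - exists (x + x'); rewrite linearD xE xE'.
    exact/esym/(linearD (mklin (comb_linear y))).
  - exists (a *: x); rewrite linearZ /= xE.
    exact/esym/(linearZ_LR (mklin (comb_linear y))).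
have xP k : exists x, i x = comb y (row k A).
  by apply/AE; exists (delta_mx 0 k); rewrite rowE.
have [x xE] := choice xP; apply/fin_genP; exists r, x => z.
have [v vE] := yY (i z); have [|w wE] := (AE v).1; first by exists z.
exists w; apply: i_inj; rewrite -vE wE comb_mul linear_sum.
by apply: eq_bigr => k _; rewrite linearZ /= xE.
Qed.

(* The integer labels are the degrees of the basis vectors of graded free modules; *)
(* [hom] is trivial for resolutions without grading. *)
Record stage (hom : forall r n, ('I_r -> int) -> ('I_n -> int) -> 'M[R]_(r, n) -> Prop) :=
  Stage { st_dim : nat; st_deg : 'I_st_dim -> int;
          st_dim' : nat; st_deg' : 'I_st_dim' -> int;
          st_mx : 'M[R]_(st_dim', st_dim);
          st_hom : hom _ _ st_deg' st_deg st_mx }.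

(** [step] is iterated along stages, the source of each matrix being the target of the next. The
    family [y] is [x] itself, restated so that its index type is ['I_(d 0)]. *)
Lemma matrix_resolution
    (hom : forall r n, ('I_r -> int) -> ('I_n -> int) -> 'M[R]_(r, n) -> Prop)
    (step : forall r n e' e (A : 'M[R]_(r, n)), hom r n e' e A ->
       exists q e'' (B : 'M[R]_(q, r)), hom q r e'' e' B /\
         forall v, v *m A = 0 <-> exists w : 'rV[R]_q, v = w *m B)
    X n e r e' (x : 'I_n -> X) (A : 'M[R]_(r, n)) :
  hom r n e' e A ->
  (forall v, comb x v = 0 <-> exists w : 'rV[R]_r, v = w *m A) ->
  exists (d : nat -> nat) (ee : forall k, 'I_(d k) -> int)
    (M : forall k, 'M[R]_(d k.+1, d k)) (y : 'I_(d 0%N) -> X),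
  [/\ forall k, hom _ _ (ee k.+1) (ee k) (M k),
      forall v, comb y v = 0 <-> exists w : 'rV_(d 1%N), v = w *m M 0%N,
      forall k (v : 'rV_(d k.+1)), v *m M k = 0 <-> exists w : 'rV_(d k.+2), v = w *m M k.+1
    & (forall z, exists v, comb x v = z) -> (forall z, exists v, comb y v = z)].
Proof.
move=> homA xA.
have next (s : stage hom) : {t : {q & {e'' : 'I_q -> int & {B : 'M[R]_(q, st_dim' s) |
    hom _ _ e'' (st_deg' (s := s)) B}}} |
    forall v, v *m st_mx s = 0 <->
      exists w : 'rV_(projT1 t), v = w *m sval (projT2 (projT2 t))}.
  apply: cid; have [q [e'' [B [homB BE]]]] := step _ _ _ _ _ (st_hom s).
  by exists (existT _ q (existT _ e'' (exist _ B homB))).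
pose nx s := let t := sval (next s) in Stage (svalP (projT2 (projT2 t))).
pose st k := iter k nx (Stage homA).
exists (fun k => st_dim (st k)), (fun k => st_deg (s := st k)), (fun k => st_mx (st k)), x.
by split=> // [k|k v]; [exact: st_hom|exact: (svalP (next (st k)))].
Qed.

Section MatrixResolution.
Variables (X : lmodType R) (d : nat -> nat) (M : forall k, 'M[R]_(d k.+1, d k)).
Variable y : 'I_(d 0%N) -> X.
Hypotheses (y_surj : forall z, exists v, comb y v = z)
  (y_exact : forall v, comb y v = 0 <-> exists w : 'rV_(d 1%N), v = w *m M 0%N)
  (M_exact : forall k (v : 'rV_(d k.+1)),
    v *m M k = 0 <-> exists w : 'rV_(d k.+2), v = w *m M k.+1).

Fact mxres_exact0 v : mklin (comb_linear y) v = 0 <->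
  exists w, (mulmxr (M 0%N) : {linear 'rV[R]_(d 1%N) -> _}) w = v.
Proof. by apply: iff_trans (y_exact v) _; split=> -[w /= e]; exists w. Qed.

Fact mxres_exactS k v : mulmxr (M k) v = 0 <->
  exists w, (mulmxr (M k.+1) : {linear 'rV[R]_(d k.+2) -> _}) w = v.
Proof. by apply: iff_trans (M_exact v) _; split=> -[w /= e]; exists w. Qed.

Definition mxres : resolution X :=
  @Resolution R X (fun k => 'rV[R]_(d k)) (fun k => mulmxr (M k))
    (mklin (comb_linear y)) y_surj mxres_exact0 mxres_exactS.

Lemma mxres_projective k : projective (mxres k).
Proof. exact: rV_projective. Qed.

End MatrixResolution.

Lemma projective_resolution_exists X : fin_gen X ->
  exists P : resolution X, forall k, projective (P k).
Proof.
case/fin_genP => n [x xX].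
have [|r [A AE]] := @noetherian_submodule n [set v | comb x v = 0].
  exact: (ker_submodule (mklin (comb_linear x))).
have [|d [ee [M [y [_ y0 MS yX]]]]] := @matrix_resolution (fun _ _ _ _ _ => True) _
   X n (fun=> 0) r (fun=> 0) x A I AE.
  move=> q k e' e B _; have [|t [C CE]] := @noetherian_submodule q [set v | v *m B = 0].
    exact: (ker_submodule (mulmxr B)).
  by exists t, (fun=> 0), C.
exists (mxres (yX xX) y0 MS); exact: mxres_projective.
Qed.

End FreeModules.

(** * Modules of G-dimension zero *)

Section Duality.
Variables (R : pzRingType) (mulC : forall x y : R, x * y = y * x).
Hypothesis noeR : noetherian R.
Implicit Types X Y A B C : lmodType R.

Lemma conv_mulC (x y : R^c) : x * y = y * x.
Proof. exact: (mulC (y : R) (x : R)). Qed.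

Lemma conv_noetherian : noetherian R^c.
Proof.
move=> I [I0 ID IM]; have [|s sE] := noeR (I := I).
  by split=> // a x Ix; rewrite mulC; exact: (IM a x Ix).
exists s; rewrite [LHS]sE; apply/seteqP; split=> x /= [c ->]; exists c;
  by apply: eq_bigr => i _; rewrite [LHS]mulC.
Qed.

Lemma reflexiveP X : bijective (@bidual_map R X) <->
  (forall x, (forall f : dual X, dual_app f x = 0) -> x = 0) /\
  (forall F : dual (dual X), exists x, forall f, dual_app F f = dual_app f x).
Proof.
split=> [[e eK Ke]|[X_inj X_surj]].
  split=> [x xf|F]; last by exists (e F) => f; rewrite -[in LHS](Ke F).
  rewrite -[x]eK -[RHS]eK; congr (e _); apply: dualP => f.
  by rewrite [LHS]xf; apply/esym; exact: (linear0 (f : {linear X -> R^o})).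
have [e eE] := choice X_surj; exists e => [x|F].
  apply/eqP; rewrite -subr_eq0; apply/eqP/X_inj => f.
  rewrite /dual_app linearB /= -[f (e _)]eE.
  exact: subrr.
by apply: dualP => f; exact: esym (eE F f).
Qed.

Fact dual_map_linear A B (f : {linear A -> B}) :
  linear (fun g : dual B => ((g : {linear B -> R^o}) \o f)%FUN : dual A).
Proof. by move=> a g h; apply: dualP. Qed.

Definition dual_map A B (f : {linear A -> B}) : {linear dual B -> dual A} :=
  mklin (dual_map_linear f).

Lemma dual_mapE A B (f : {linear A -> B}) (g : dual B) x :
  dual_app (dual_map f g) x = dual_app g (f x).
Proof. by []. Qed.

(** A surjection from a free module onto X embeds the dual of X into the dual of that free module,
    and [R^c] is again Noetherian. *)
Lemma fin_gen_dual X : fin_gen X -> fin_gen (dual X).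
Proof.
case/fin_genP => n [x xX].
apply: (fin_gen_submodule conv_noetherian (i := dual_map (mklin (comb_linear x)))).
  move=> f g fg; apply: dualP => z; have [v <-] := xX z.
  exact: (congr1 (fun h => dual_app h v) fg).
have c_lin i : linear (fun v : 'rV[R]_n => v 0 i : R^o).
  by move=> a u v; rewrite !mxE.
exists n, (fun i => mklin (c_lin i) : dual _) => f.
exists (fun i => dual_app f (delta_mx 0 i)); apply: dualP => v.
have /= E := linear_comb (f : {linear 'rV[R]_n -> R^o}) v.
rewrite [LHS]E /comb.
have sumE I (r : seq I) (F : I -> dual 'rV[R]_n) :
    dual_app (\sum_(i <- r) F i) v = \sum_(i <- r) dual_app (F i) v.
  by elim/big_rec2: _ => // i y1 y2 _ <-.
by rewrite sumE.
Qed.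

Lemma short_exact_dual A B C (i : {linear A -> B}) (p : {linear B -> C}) :
  short_exact i p ->
  (forall f : {linear A -> R^o}, exists g : {linear B -> R^o}, forall x, g (i x) = f x) ->
  short_exact (dual_map p) (dual_map i).
Proof.
move=> [i_inj p_surj ipE] ext; split.
- move=> f g fg; apply: dualP => z; have [y <-] := p_surj z.
  exact: (congr1 (fun h => dual_app h y) fg).
- move=> f; have [g gE] := ext f; exists g; apply: dualP; exact: gE.
- move=> g; split=> [g0|[h <-]].
    have [y|h hE] := lin_descend (f := g : {linear B -> R^o}) p_surj.
      by move=> /ipE[x <-]; exact: (congr1 (fun h => dual_app h x) g0).
    by exists h; apply: dualP; exact: hE.
  apply: dualP => x; rewrite !dual_mapE.
  have -> : p (i x) = 0 by apply/ipE; exists x.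
  exact: (linear0 (h : {linear C -> R^o})).
Qed.

Lemma Ext_zero1_extend A B C (i : {linear A -> B}) (p : {linear B -> C}) Y :
  short_exact i p -> fin_gen A -> fin_gen C -> Ext_zero 1 C Y ->
  forall f : {linear A -> Y}, exists g : {linear B -> Y}, forall x, g (i x) = f x.
Proof.
move=> ip fgA fgC CY.
have [P Pproj] := projective_resolution_exists noeR fgA.
have [Q Qproj] := projective_resolution_exists noeR fgC.
exact: (coh_extend ip P Qproj (CY Q Qproj)).
Qed.
End Duality.

Section GorensteinZero.
Variables (R : pzRingType) (mulC : forall x y : R, x * y = y * x).
Hypothesis noeR : noetherian R.
Variables (A B C : lmodType R) (i : {linear A -> B}) (p : {linear B -> C}).
Hypothesis ip : short_exact i p.

Lemma Ext_zero_right k (Y : lmodType R) : fin_gen A ->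
  Ext_zero k.+1 A Y -> Ext_zero k.+2 B Y -> Ext_zero k.+2 C Y.
Proof.
move=> fgA HA HB Q Qproj f fd.
have [P Pproj] := projective_resolution_exists noeR fgA.
have [|_ -> [g gE]] := Ext_torsion_right mulC ip Pproj Qproj (S := [set 1]) HB _ fd.
  by move=> h hd; exists 1 => //; have [g gE] := HA P Pproj h hd; exists g => y; rewrite scale1r.
by exists g => y; rewrite -gE scale1r.
Qed.

Hypotheses (A0 : Gdim_zero A) (B0 : Gdim_zero B).
Hypothesis ext : forall f : {linear A -> R^o},
  exists g : {linear B -> R^o}, forall x, g (i x) = f x.

(** As Ext^1(B, R) = 0, the hypothesis [ext] amounts to Ext^1(C, R) = 0. So the duals again form a
    short exact sequence; reflexivity follows by a chase between the two sequences, and each Ext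
    condition from a long exact sequence. *)
Lemma Gdim_zero_coker : Gdim_zero C.
Proof.
case: A0 B0 => fgA Arefl AR AsR [fgB Brefl BR BsR].
have [i_inj p_surj ipE] := ip.
have fgC := fin_gen_surj p_surj fgB.
have ip' := short_exact_dual ip ext.
have fgAs := fin_gen_dual mulC noeR fgA.
have fgCs := fin_gen_dual mulC noeR fgC.
have noeC := conv_noetherian mulC noeR.
split=> //.
- have [A_inj A_surj] := (reflexiveP A).1 Arefl.
  have [B_inj B_surj] := (reflexiveP B).1 Brefl.
  apply/reflexiveP; split=> [x xf|F].
    have [b bE] := p_surj x.
    (* Evaluation at [b] kills the functionals coming from C, so it descends to the dual of A, where
       it is evaluation at some [a]; then [b = i a]. *)
    have [|G GE] := lin_descend (p := dual_map i) (f := eval_fun b) (let: And3 _ s _ := ip' in s).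
      move=> f fi; have [_ _ /(_ f)[+ _]] := ip'; move=> /(_ fi)[g <-].
      by rewrite -[LHS]/(dual_app g (p b)) bE; exact: xf.
    have [a aE] := A_surj G.
    have : b - i a = 0.
      apply: B_inj => f; rewrite /dual_app linearB /=.
      apply/eqP; rewrite subr_eq0; apply/eqP.
      have := GE f; rewrite [LHS]aE dual_mapE => /esym E; exact: E.
    move/subr0_eq => ba; rewrite -bE ba; apply/ipE; by exists a.
  (* Ext^1 of the dual of A vanishes, so [F] extends from the dual of C to that of B. *)
  have [G GE] := Ext_zero1_extend noeC ip' fgCs fgAs (AsR 1%N isT) F.
  have [b bE] := B_surj G; exists (p b) => f.
  by rewrite /dual_app -[LHS]GE [LHS]bE.
- case=> [//|[|k]] _; last by apply: Ext_zero_right => //; [exact: AR|exact: BR].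
  move=> Q Qproj f fd.
  have [P Pproj] := projective_resolution_exists noeR fgA.
  have [|_ -> [g gE]] := Ext_torsion_right0 mulC ip Pproj Qproj (S := [set 1]) (BR 1%N isT) _ fd.
    by move=> h; exists 1 => //; have [g gE] := ext h; exists g => y; rewrite scale1r gE.
  by exists g => y; rewrite -gE scale1r.
case=> [//|k] _ P Pproj.
have [Q Qproj] := projective_resolution_exists noeC fgAs.
apply: (Ext_zero_left ip' Pproj Qproj); first exact: BsR.
exact: AsR.
Qed.

End GorensteinZero.

(** * Finite resolutions by modules of G-dimension zero *)

Section GResolution.
Variables (R : pzRingType) (mulC : forall x y : R, x * y = y * x).
Hypothesis noeR : noetherian R.
Implicit Types X Y A B C G K : lmodType R.

(** Recursive form of [Gdim_le], peeling off one syzygy at a time for dimension shifting. *)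
Fixpoint Gres n X : Prop :=
  if n is n'.+1 then exists (K G : lmodType R) (i : {linear K -> G}) (p : {linear G -> X}),
    [/\ short_exact i p, Gdim_zero G & Gres n' K]
  else Gdim_zero X.

Lemma Gres_fin_gen n X : Gres n X -> fin_gen X.
Proof.
case: n => [|n] /=; first by case.
by case=> K [G [i [p [[_ p_surj _] [fgG _ _ _] _]]]]; exact: fin_gen_surj p_surj fgG.
Qed.

(** Dimension shifting moves Ext^(n+1)(X, R) to Ext^1 of the n-th syzygy, which then has G-dimension
    zero by [Gdim_zero_coker]. Any projective [Q] may be used, in particular a graded one. *)
Lemma Gres_coh_zero n X (Q : resolution X) : (forall k, projective (Q k)) ->
  Gres n.+1 X -> coh_zero Q n.+1 R^o -> Gres n X.
Proof.
elim: n X Q => [|n IH] X Q Qproj /= [K [G [i [p [ip G0]]]]].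
  move=> K0 QR; apply: (Gdim_zero_coker mulC noeR ip) => //.
  have [fgK _ _ _] := K0; have [P Pproj] := projective_resolution_exists noeR fgK.
  exact: (coh_extend ip P Qproj QR).
move=> KG QR; have fgK := Gres_fin_gen (n := n.+1) KG.
have [P Pproj] := projective_resolution_exists noeR fgK.
exists K, G, i, p; split=> //; apply: (IH K P Pproj) => //.
by apply: (Ext_zero_left ip Pproj Qproj) => //; case: G0 => _ _ + _; apply.
Qed.

Section Shift.
Variables (X : lmodType R) (C : resolution X).

(** The first syzygy is realised as C_1 modulo the kernel of its differential. Keeping
    [D k = C k.+1] as an equality lets [Gdim_zero] be transported by rewriting. *)
Lemma res_shift : exists (K : lmodType R) (D : resolution K)
    (i : {linear K -> C 0%N}),
  short_exact i (res_aug C) /\ forall k, D k = C k.+1.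
Proof.
have [K [p [p_surj pE]]] := quotient_exists (ker_submodule (res_diff C 0%N)).
have [z|i iE] := lin_descend (f := res_diff C 0%N) p_surj; first by move/pE.
have ex0 z : p z = 0 <-> exists w, res_diff C 1%N w = z.
  by apply: iff_trans (pE z) _; exact: res_exactS.
exists K, (@Resolution R K (fun k => C k.+1) (fun k => res_diff C k.+1) p
  p_surj ex0 (fun k => @res_exactS _ _ C k.+1)), i; split=> //; split.
- move=> x y; have [x' <-] := p_surj x; have [y' <-] := p_surj y.
  rewrite !iE => xy; apply/eqP; rewrite -subr_eq0 -linearB; apply/eqP/pE.
  by rewrite /= linearB xy subrr.
- exact: res_aug_surj.
- move=> y; apply: (iff_trans (res_exact0 y)); split=> [[z <-]|[x <-]].
    by exists (p z).
  by have [z <-] := p_surj x; exists z.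
Qed.
End Shift.

Lemma resolution_Gres n X (C : resolution X) :
  (forall i, (i <= n.+1)%N -> Gdim_zero (C i)) ->
  (forall i, (n.+1 < i)%N -> forall y : C i, y = 0) -> Gres n.+1 X.
Proof.
elim: n X C => [|n IH] X C CG C0.
  exists (C 1%N), (C 0%N), (res_diff C 0%N), (res_aug C).
  split; [|exact: CG|exact: CG]; split.
  - move=> x y xy; have /res_exactS[z zE] : res_diff C 0%N (x - y) = 0.
      by rewrite linearB xy subrr.
    by apply/eqP; rewrite -subr_eq0 -zE (C0 2%N isT z) linear0.
  - exact: res_aug_surj.
  - exact: res_exact0.
have [K [D [i [ip DE]]]] := res_shift C.
exists K, (C 0%N), i, (res_aug C); split=> //; first exact: CG.
by apply: (IH K D) => j jn; rewrite DE; [apply: CG|apply: C0].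
Qed.

Lemma Gres_resolution n X : Gres n X -> exists C : resolution X,
  (forall i, (i <= n)%N -> Gdim_zero (C i)) /\
  (forall i, (n < i)%N -> forall y : C i, y = 0).
Proof.
elim: n X => [|n IH] X /=.
  move=> X0; pose M k : lmodType R := if k is 0%N then X else 'rV[R]_0.
  pose d k : {linear M k.+1 -> M k} := \0.
  have e0 (y : M 0%N) : (idfun : {linear X -> X}) y = 0 <-> exists z, d 0%N z = y.
    by split=> [y0|[z <-]] //; exists 0; exact: esym y0.
  have eS k y : d k y = 0 <-> exists z, d k.+1 z = y.
    by split=> // _; exists 0; rewrite [RHS]thinmx0.
  exists (@Resolution R X M d idfun (fun x => ex_intro _ x erefl) e0 eS).
  split=> [[|i] //|[|i] // _ y]; exact: thinmx0.
case=> K [G [i [p [[i_inj p_surj ipE] G0 /IH[C [CG C0]]]]]].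
pose M k : lmodType R := if k is k'.+1 then C k' else G.
pose d k : {linear M k.+1 -> M k} :=
  match k return {linear M k.+1 -> M k} with
  | 0%N => (i \o res_aug C)%FUN | k'.+1 => res_diff C k' end.
have e0 (y : M 0%N) : p y = 0 <-> exists z, d 0%N z = y.
  split=> [/ipE[x <-]|[z <-]]; last by apply/ipE; exists (res_aug C z).
  by have [z <-] := res_aug_surj C x; exists z.
have eS k y : d k y = 0 <-> exists z, d k.+1 z = y.
  case: k y => [|k] y; last exact: res_exactS.
  rewrite -res_exact0 /=; split=> [iy|->]; last exact: linear0.
  by apply: i_inj; rewrite iy linear0.
exists (@Resolution R X M d p p_surj e0 eS); split=> -[|k] //= kn; first exact: CG.
exact: C0.
Qed.

Lemma Gdim_leP n X : Gdim_le X n <-> Gres n X.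
Proof.
case: n => [//|n]; split=> [[C [CG C0]]|/Gres_resolution //].
exact: resolution_Gres CG C0.
Qed.

End GResolution.

(** * Regular elements and regular sequences *)

Section MaximalAnnihilators.
Variables (R : pzRingType) (mulC : forall x y : R, x * y = y * x).
Hypothesis noeR : noetherian R.

Lemma noetherian_maximal (F : set (set R)) (I0 : set R) : F I0 ->
  (forall I, F I -> ideal I) ->
  exists2 I, F I & forall J, F J -> I `<=` J -> J `<=` I.
Proof.
move=> FI0 Fid; apply: contrapT => nomax.
have next (I : {I | F I}) : {J : {J | F J} | sval I `<=` sval J /\ ~ sval J `<=` sval I}.
  apply: cid; case: I => I FI /=; apply: contrapT => nJ; apply: nomax.
  exists I => // J FJ IJ; apply: contrapT => JI; apply: nJ.
  by exists (exist _ J FJ).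
have [f [_ fS]] := dependent_choice next (exist _ I0 FI0).
pose I n := sval (f n).
have Imono n k : I n `<=` I (n + k)%N.
  elim: k => [|k IH]; rewrite ?addn0 // addnS => x /IH; by case: (fS (n + k)%N) => + _; apply.
have IU : ideal [set x | exists n, I n x].
  split=> [|x y [p px] [q qy]|a x [p px]].
  - by exists 0%N; case: (Fid _ (svalP (f 0%N))).
  - exists (p + q)%N; case: (Fid _ (svalP (f (p + q)%N))) => _ ID _.
    by apply: ID; [exact: Imono|rewrite addnC; exact: Imono].
  - by exists p; case: (Fid _ (svalP (f p))) => _ _; apply.
have [s sE] := noeR IU.
have /choice[b bP] (i : 'I_(size s)) : exists n, I n s`_i.
  suff : [set x | exists n, I n x] s`_i by [].
  by rewrite sE; exact: nth_lincomb.
pose N := (\sum_i b i)%N.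
have [_ []] := fS N => x xN.
have : [set x | exists n, I n x] x by exists N.+1.
rewrite sE => -[c ->]; have [I0' ID IM] := Fid _ (svalP (f N)).
apply: (big_ind (I N)) => // i _; apply: IM.
by rewrite /N (bigD1 i) //=; exact: Imono.
Qed.

Variable Y : lmodType R.
Hypothesis fgY : fin_gen Y.

(** The annihilator of such a [y] is maximal among annihilators of nonzero elements, hence prime;
    associated primes are handled through these elements. *)
Definition maximal_ann (y : Y) := y <> 0 /\
  forall z : Y, z <> 0 -> (forall a, a *: y = 0 -> a *: z = 0) ->
  forall a, a *: z = 0 -> a *: y = 0.

Lemma maximal_ann_prime y a b : maximal_ann y -> a *: y <> 0 -> b *: y <> 0 ->
  (a * b) *: y <> 0.
Proof.
move=> [_ ymax] ay by0 ab; apply: ay; apply: (ymax _ by0); last by rewrite scalerA.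
by move=> c cy; rewrite scalerA mulC -scalerA cy scaler0.
Qed.

Lemma maximal_ann_exists (z : Y) : z <> 0 ->
  exists2 y, maximal_ann y & forall a, a *: z = 0 -> a *: y = 0.
Proof.
move=> z0.
pose ann (y : Y) := [set a : R | a *: y = 0].
have [||_ [y [y0 zy] <-] ymax] := @noetherian_maximal
  [set I | exists2 y, y <> 0 /\ ann z `<=` ann y & ann y = I] (ann z).
- by exists z => //; split=> // a.
- move=> _ [y _ <-]; split=> [|a b ay by0|a b by0] /=; rewrite /ann /=.
  + by rewrite scale0r.
  + by rewrite scalerDl ay by0 addr0.
  + by rewrite -scalerA by0 scaler0.
exists y => //; split=> // x x0 yx; apply: (ymax (ann x)) => //.
by exists x => //; split=> // a /zy /yx.
Qed.

(** Since ann(y) is prime, a product of one element of J and one element of each ann(t), all taken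
    outside ann(y), stays outside ann(y). *)
Lemma maximal_ann_avoid y (J : set R) (T : seq Y) : maximal_ann y ->
  (forall a x, J x -> J (a * x)) -> (exists2 c, J c & c *: y <> 0) ->
  (forall t, t \in T -> exists2 c, c *: t = 0 & c *: y <> 0) ->
  exists b, [/\ J b, b *: y <> 0 & forall t, t \in T -> b *: t = 0].
Proof.
move=> ymax JM [c Jc cy]; elim: T => [|t T IH] HT; first by exists c.
have [b [Jb by0 bT]] := IH (fun u uT => HT u (@mem_behead _ (t :: T) _ uT)).
have [d dt dy] := HT t (mem_head _ _).
exists (d * b); split; [exact: JM|exact: maximal_ann_prime|] => u.
rewrite inE => /orP[/eqP->|uT]; first by rewrite mulC -scalerA dt scaler0.
by rewrite -scalerA bT // scaler0.
Qed.

(** Stands for the finiteness of the maximal associated primes. The elements whose annihilator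
    contains a finite intersection of such primes form a submodule; as it is finitely generated, one
    finite list serves for all of it. *)
Lemma maximal_ann_finite : exists T : seq Y,
  (forall t, t \in T -> maximal_ann t) /\
  forall y, maximal_ann y -> forall a, (forall t, t \in T -> a *: t = 0) -> a *: y = 0.
Proof.
pose W := [set y : Y | exists T : seq Y, (forall t, t \in T -> maximal_ann t) /\
  forall a, (forall t, t \in T -> a *: t = 0) -> a *: y = 0].
have [n [x xY]] := (fin_genP Y).1 fgY.
have [|r [A AE]] := noetherian_submodule noeR (N := [set v : 'rV[R]_n | W (comb x v)]).
  have cE : comb x = mklin (comb_linear x) by [].
  split=> [|u v [T [Tmax TE]] [T' [Tmax' TE']]|a v [T [Tmax TE]]].
  - by exists [::]; split=> // a _; rewrite cE linear0 scaler0.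
  - exists (T ++ T'); split=> [t|a aT].
      by rewrite mem_cat => /orP[]; [exact: Tmax|exact: Tmax'].
    rewrite cE linearD scalerDr [X in X + _]TE ?[X in _ + X]TE' ?addr0 // => t tT.
      by apply: aT; rewrite mem_cat tT orbT.
    by apply: aT; rewrite mem_cat tT.
  - exists T; split=> // b bT; rewrite cE linearZ /= scalerA mulC -scalerA.
    by rewrite [X in _ *: X]TE // scaler0.
have /choice[T TE] (k : 'I_r) : W (comb x (row k A)).
  by apply/AE; exists (delta_mx 0 k); rewrite rowE.
exists (flatten [seq T k | k <- enum 'I_r]); split=> [t /flattenP[_ /mapP[k _ ->]]|y ymax a aT].
  by case: (TE k) => + _; apply.
have [v vE] := xY y; have [|w wE] := (AE v).1.
  by exists [:: y]; rewrite vE; split=> [t|b bT]; [rewrite inE => /eqP->|apply: bT; rewrite inE].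
rewrite -vE wE comb_mul /comb scaler_sumr big1 // => k _.
rewrite scalerA mulC -scalerA; case: (TE k) => _ ->; rewrite ?scaler0 // => t tk.
by apply: aT; apply/flattenP; exists (T k) => //; apply/mapP; exists k; rewrite ?mem_enum.
Qed.

(** Prime avoidance for m and the annihilators of the members of T. A nonzero element killed by [a]
    would give a [y] with maximal annihilator containing [a], and ann(y) is the annihilator of some
    member of T. *)
Lemma regular_element_exists (m : set R) : ideal m ->
  (forall y : Y, (forall a, m a -> a *: y = 0) -> y = 0) ->
  exists2 a, m a & forall y : Y, a *: y = 0 -> y = 0.
Proof.
move=> [m0 mD mM] mY; have [T [Tmax TE]] := maximal_ann_finite.
suff [a ma aT] : exists2 a, m a & forall t, t \in T -> a *: t <> 0.
  exists a => // z az; apply: contrapT => z0.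
  have [y ymax zy] := maximal_ann_exists z0.
  (* ann(y) contains the intersection of the ann(t); being prime, it contains one of them. *)
  have [t tT ty] : exists2 t, t \in T & forall c, c *: t = 0 -> c *: y = 0.
    apply: contrapT => nT.
    have [||t tT|b [_ by0 bT]] := maximal_ann_avoid ymax (J := setT) (T := T) => //.
    - by exists 1 => //; rewrite scale1r; case: ymax.
    - apply: contrapT => nc; apply: nT; exists t => // c ct; apply: contrapT => cy.
      by apply: nc; exists c.
    - by apply: by0; apply: TE.
  by apply: (aT _ tT); have [_ tmax] := Tmax _ tT; apply: (tmax y) (zy _ az); first case: ymax.
elim: T Tmax {TE} => [|t T IH] Tmax; first by exists 0.
have [a ma aT] := IH (fun u uT => Tmax u (@mem_behead _ (t :: T) _ uT)).
have tmax := Tmax t (mem_head _ _).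
have [at0|at0] := pselect (a *: t = 0); last first.
  by exists a => // u; rewrite inE => /orP[/eqP->|/aT].
(* [a] works for T but kills [t], so some [b] in m is added that kills all of T but not [t]. No
   ann(u) lies in ann(t): by maximality they would agree, and [a] would kill [u]. *)
have [||u uT|b [mb bt bT]] := maximal_ann_avoid tmax (J := m) (T := T) => //.
- apply: contrapT => nc; case: (tmax) => t0 _; apply/t0/mY => c mc.
  by apply: contrapT => ct; apply: nc; exists c.
- apply: contrapT => nc; have [u0 umax] := Tmax u (@mem_behead _ (t :: T) _ uT).
  apply: (aT u uT); apply: (umax t) at0; first by case: tmax.
  by move=> c cu; apply: contrapT => ct; apply: nc; exists c.
exists (a + b); first exact: mD.
move=> u; rewrite inE => /orP[/eqP->|uT]; first by rewrite scalerDl at0 add0r.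
by rewrite scalerDl bT // addr0; exact: aT.
Qed.

End MaximalAnnihilators.

Section RegularSequences.
Variables (R : pzRingType) (mulC : forall x y : R, x * y = y * x).
Implicit Types (X Y A B C Q : lmodType R) (s : seq R).

(** The first clause of [regular_seq]; the properness clause is supplied later by a socle
    element. *)
Definition weak_regular X s := forall i, (i < size s)%N -> forall x : X,
  seq_span (take i s) (s`_i *: x) -> seq_span (take i s) x.

Lemma seq_span_nil X (x : X) : seq_span [::] x <-> x = 0.
Proof.
by split=> [[v ->]|->]; [rewrite big_ord0|exists (fun=> 0); rewrite big_ord0].
Qed.

Lemma seq_span_rcons X s a (x : X) :
  seq_span (rcons s a) x <-> exists2 y, seq_span s y & exists w, x = y + a *: w.
Proof.
have E (v : nat -> X) : \sum_(i < size (rcons s a)) (rcons s a)`_i *: v i =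
    \sum_(i < size s) s`_i *: v i + a *: v (size s) :> X.
  rewrite size_rcons big_ord_recr /= nth_rcons ltnn eqxx; congr (_ + _).
  by apply: eq_bigr => i _; rewrite nth_rcons ltn_ord.
split=> [[v ->]|[y [v ->] [w ->]]].
  by rewrite E; eexists; [exists v|exists (v (size s))].
pose v' i := if (i < size s)%N then v i else w.
exists v'; rewrite (E v') /v' ltnn; congr (_ + _).
by apply: eq_bigr => i _; rewrite ltn_ord.
Qed.

Lemma seq_span_submodule X s : submodule (@seq_span R X s).
Proof.
split=> [|_ _ [u ->] [v ->]|a _ [v ->]].
- by exists (fun=> 0); rewrite big1 // => i _; rewrite scaler0.
- exists (fun i => u i + v i); rewrite -big_split.
  by apply: eq_bigr => i _; rewrite scalerDr.
- exists (fun i => a *: v i); rewrite scaler_sumr.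
  by apply: eq_bigr => i _; rewrite !scalerA mulC.
Qed.

Lemma seq_span_linear X Y (f : {linear X -> Y}) s x : seq_span s x -> seq_span s (f x).
Proof.
move=> [v ->]; exists (f \o v); rewrite linear_sum.
by apply: eq_bigr => i _; rewrite linearZ.
Qed.

Lemma weak_regular_rcons X s a : weak_regular X (rcons s a) <->
  weak_regular X s /\ forall x : X, seq_span s (a *: x) -> seq_span s x.
Proof.
split=> [reg|[reg ra] i].
  split=> [i is_ x|x].
    have := reg i; rewrite size_rcons ltnS => /(_ (ltnW is_) x).
    by rewrite nth_rcons is_ -cats1 takel_cat // ltnW.
  have := reg (size s); rewrite size_rcons ltnSn => /(_ isT x).
  by rewrite nth_rcons ltnn eqxx -cats1 take_size_cat.
rewrite size_rcons ltnS leq_eqVlt => /orP[/eqP->|is_] x.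
  by rewrite nth_rcons ltnn eqxx -cats1 take_size_cat //; exact: ra.
by rewrite nth_rcons is_ -cats1 takel_cat; [exact: reg|exact: ltnW].
Qed.

Lemma mem_rcons_sub (m : set R) s a : (forall b, b \in rcons s a -> m b) <->
  (forall b, b \in s -> m b) /\ m a.
Proof.
split=> [H|[H ma] b]; first by split=> [b bs|]; apply: H; rewrite mem_rcons inE ?bs ?orbT ?eqxx.
by rewrite mem_rcons inE => /orP[/eqP->|/H].
Qed.

(* Regularity of C makes Tor_1(C, R/s) vanish. *)
Lemma seq_span_exact A B C (i : {linear A -> B}) (p : {linear B -> C}) s x :
  short_exact i p -> weak_regular C s -> seq_span s (i x) -> seq_span s x.
Proof.
move=> [i_inj p_surj ipE]; elim/last_ind: s x => [|s a IH] x.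
  by move=> _ /seq_span_nil ix; apply/seq_span_nil/i_inj; rewrite ix linear0.
move=> /weak_regular_rcons[reg ra] /seq_span_rcons[y sy [b ixE]].
have pi z : p (i z) = 0 by apply/ipE; exists z.
(* In C the relation says that a p(b) lies in sC, so p(b) does by regularity, and [b] can be changed
   by an element of sB so as to come from A. *)
have /ra[v vE] : seq_span s (a *: p b).
  have /eqP : p (i x) = 0 by exact: pi.
  rewrite ixE linearD linearZ /= addrC addr_eq0 => /eqP->.
  by apply: submoduleN; [exact: seq_span_submodule|exact: seq_span_linear].
have [v' v'E] := choice (fun k => p_surj (v k)).
have [x' x'E] : exists x', i x' = b - \sum_(k < size s) s`_k *: v' k.
  apply/ipE; rewrite linearB linear_sum vE; apply/eqP; rewrite subr_eq0; apply/eqP.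
  by apply: eq_bigr => k _; rewrite linearZ /= v'E.
have : seq_span s (i (x - a *: x')).
  rewrite linearB linearZ /= x'E scalerBr ixE opprB addrA addrAC.
  rewrite addrK; have [_ sD sZ] := @seq_span_submodule B s.
  by apply: sD => //; apply: sZ; exists v'.
move/(IH _ reg) => sx; apply/seq_span_rcons; exists (x - a *: x') => //.
by exists x'; rewrite subrK.
Qed.

Lemma weak_regular_pair A B s :
  weak_regular (A * B)%type s -> weak_regular A s /\ weak_regular B s.
Proof.
have pE t (x : A) (y : B) : seq_span t (x, y) <-> seq_span t x /\ seq_span t y.
  have fst_lin : linear (fst : A * B -> A) by [].
  have snd_lin : linear (snd : A * B -> B) by [].
  split=> [H|[[u ->] [v ->]]].
    by split; [exact: (seq_span_linear (mklin fst_lin) H)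
              |exact: (seq_span_linear (mklin snd_lin) H)].
  exists (fun i => (u i, v i)); apply: injective_projections.
    exact/esym/(linear_sum (mklin fst_lin)).
  exact/esym/(linear_sum (mklin snd_lin)).
move=> reg; have z0 C t : seq_span t (0 : C) by case: (@seq_span_submodule C t).
split=> i si x ix.
  suff /pE[] : seq_span (take i s) ((x, 0) : A * B) by [].
  apply: reg => //; rewrite -[_ *: _]/(s`_i *: x, s`_i *: (0 : B)) scaler0.
  exact/pE.
suff /pE[] : seq_span (take i s) ((0, x) : A * B) by [].
apply: reg => //; rewrite -[_ *: _]/(s`_i *: (0 : A), s`_i *: x) scaler0.
exact/pE.
Qed.

(** What drives the inductions along a sequence: multiplication by [a] on X/sX is injective with
    cokernel X/(s,a)X. *)
Lemma short_exact_span X s a Q Q' (p : {linear X -> Q}) (p' : {linear X -> Q'}) :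
  (forall q, exists x, p x = q) -> (forall x, p x = 0 <-> seq_span s x) ->
  (forall q, exists x, p' x = q) -> (forall x, p' x = 0 <-> seq_span (rcons s a) x) ->
  (forall x : X, seq_span s (a *: x) -> seq_span s x) ->
  exists pi : {linear Q -> Q'}, short_exact (mklin (@scale_linear _ mulC Q a)) pi /\
    forall x, pi (p x) = p' x.
Proof.
move=> p_surj pE p'_surj p'E ra.
have [x|pi piE] := lin_descend (f := p') p_surj.
  move/pE => sx; apply/p'E/seq_span_rcons; exists x => //.
  by exists 0; rewrite scaler0 addr0.
exists pi; split=> //; split=> [x y|q|q].
- have [x' <-] := p_surj x; have [y' <-] := p_surj y.
  rewrite /= => axy; apply/eqP; rewrite -subr_eq0 -linearB; apply/eqP/pE/ra/pE.
  by rewrite linearZ /= linearB scalerBr axy subrr.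
- by have [x <-] := p'_surj q; exists (p x).
- have [x <-] := p_surj q; rewrite piE; split=> [/p'E/seq_span_rcons[y /pE y0 [w ->]]|].
    by exists (p w); rewrite linearD y0 add0r linearZ.
  case=> q' /= aq; have [w wE] := p_surj q'.
  apply/p'E/seq_span_rcons; exists (x - a *: w); last by exists w; rewrite subrK.
  by apply/pE; rewrite linearB linearZ /= wE aq subrr.
Qed.

End RegularSequences.

(** * Depth and Ext(R/m, -) *)

Section Depth.
Variables (R : pzRingType) (mulC : forall x y : R, x * y = y * x).
Hypothesis noeR : noetherian R.
Variables (m : set R) (mid : ideal m).
Variables (kappa : lmodType R) (u : kappa) (P : resolution kappa).
Hypotheses (kappa_gen : forall x : kappa, exists a, a *: u = x)
  (kappa_ann : forall a, a *: u = 0 <-> m a).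
Hypothesis Pproj : forall i, projective (P i).
Implicit Types (X Y A B C Q : lmodType R) (s : seq R).

Fact scaler_linear X (x : X) : linear (fun a : R^o => (a : R) *: x).
Proof. by move=> a b c; rewrite scalerDl scalerA. Qed.

Lemma kappa_killed a (x : kappa) : m a -> a *: x = 0.
Proof.
by move=> /kappa_ann au; have [b <-] := kappa_gen x; rewrite scalerA mulC -scalerA au scaler0.
Qed.

Lemma coh_zero0P Y : coh_zero P 0 Y <->
  forall y : Y, (forall a, m a -> a *: y = 0) -> y = 0.
Proof.
split=> [HY y my|HY f fd y].
  have [a|f fE] := lin_descend (p := mklin (scaler_linear u))
      (f := mklin (scaler_linear y)) kappa_gen; first by move/kappa_ann/my.
  have [z zu] := res_aug_surj P u.
  have /= := HY (f \o res_aug P)%FUN _ z; rewrite zu.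
  have /= := fE 1; rewrite !scale1r => ->; apply=> w.
  by rewrite /= res_aug_d linear0.
have [x|g gE] := lin_descend (f := f) (res_aug_surj P).
  by move=> /res_exact0[z <-].
have gu : g u = 0.
  by apply: HY => a /kappa_ann au; rewrite -linearZ /= au linear0.
have [a aE] := kappa_gen (res_aug P y).
by rewrite -gE -aE linearZ /= gu scaler0.
Qed.

Lemma coh_zero_iso k X Q (p : {linear X -> Q}) : (forall q, exists x, p x = q) ->
  injective p -> coh_zero P k Q -> coh_zero P k X.
Proof.
move=> p_surj p_inj HQ f fd.
have pfd z : (p \o f)%FUN (res_diff P k z) = 0 by rewrite /= fd linear0.
case: k f fd pfd HQ => [|k] f fd pfd HQ.
  by move=> y; apply: p_inj; rewrite linear0; exact: (HQ (p \o f)%FUN pfd).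
have [g gE] := HQ (p \o f)%FUN pfd.
have [|h hE] := @lin_factor _ _ _ _ p g p_inj; first by move=> x.
by exists h => y; apply: p_inj; rewrite hE -gE.
Qed.

Lemma seq_span_nil_inj X Q (p : {linear X -> Q}) :
  (forall x, p x = 0 <-> seq_span [::] x) -> injective p.
Proof.
move=> pE x y xy; apply/eqP; rewrite -subr_eq0; apply/eqP/seq_span_nil/pE.
by rewrite linearB xy subrr.
Qed.

(** Removing the last element [a]: it kills R/m, hence the cohomology of Q = X/sX. So in the long
    exact sequence of multiplication by [a], vanishing for Q/aQ in degree i forces vanishing for Q
    in degree i + 1. *)
Lemma coh_zero_lift X s : weak_regular X s -> (forall a, a \in s -> m a) ->
  forall k Q (p : {linear X -> Q}), (forall q, exists x, p x = q) ->
  (forall x, p x = 0 <-> seq_span s x) ->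
  (forall i, (i < k)%N -> coh_zero P i Q) ->
  forall i, (i < size s + k)%N -> coh_zero P i X.
Proof.
elim/last_ind: s => [|s a IH].
  move=> _ _ k Q p p_surj pE HQ i ik.
  by apply: (coh_zero_iso p_surj (seq_span_nil_inj pE)); exact: HQ.
move=> /weak_regular_rcons[reg ra] /mem_rcons_sub[ms ma] k Q' p' p'_surj p'E HQ'.
have [Q [p [p_surj pE]]] := quotient_exists (@seq_span_submodule _ mulC X s).
have [pi [aex _]] := short_exact_span mulC p_surj pE p'_surj p'E ra.
rewrite size_rcons addSnnS; apply: (IH reg ms k.+1 Q p p_surj pE) => -[|i] ik.
  apply/coh_zero0P => q qm; have [a_inj _ _] := aex.
  by apply: a_inj; rewrite linear0 /=; exact: qm.
move=> f fd; have [g gE] := ann_coh mulC Pproj (fun x => kappa_killed x ma) fd.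
exact: (coh_zero_sub Pproj aex (HQ' i ik) gE).
Qed.

(** The opposite direction is the long exact sequence alone; each element of [s] shortens the range
    of vanishing by one. *)
Lemma coh_zero_mod X s : weak_regular X s ->
  forall k Q (p : {linear X -> Q}), (forall q, exists x, p x = q) ->
  (forall x, p x = 0 <-> seq_span s x) ->
  (forall i, (i < size s + k)%N -> coh_zero P i X) ->
  forall i, (i < k)%N -> coh_zero P i Q.
Proof.
elim/last_ind: s => [|s a IH].
  move=> _ k Q p p_surj pE HX i ik.
  have [x|q qE] := lin_descend (f := idfun : {linear X -> X}) p_surj.
    by move/pE/seq_span_nil.
  apply: (coh_zero_iso (p := q)); last exact: HX.
    by move=> x; exists (p x).
  by move=> x y; have [x' <-] := p_surj x; have [y' <-] := p_surj y; rewrite !qE /= => ->.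
move=> /weak_regular_rcons[reg ra] k Q' p' p'_surj p'E HX i ik.
have [Q [p [p_surj pE]]] := quotient_exists (@seq_span_submodule _ mulC X s).
have [pi [aex _]] := short_exact_span mulC p_surj pE p'_surj p'E ra.
have HQ : forall i, (i < k.+1)%N -> coh_zero P i Q.
  by apply: (IH reg k.+1 Q p p_surj pE) => j; rewrite -addSnnS -(size_rcons s a); exact: HX.
apply: (coh_zero_quo Pproj aex); apply: HQ; [exact: ltnW|exact: ik].
Qed.

Lemma weak_regular_coh X s : weak_regular X s -> (forall a, a \in s -> m a) ->
  forall i, (i < size s)%N -> coh_zero P i X.
Proof.
move=> reg ms i.
have [Q [p [p_surj pE]]] := quotient_exists (@seq_span_submodule _ mulC X s).
by rewrite -(addn0 (size s)); apply: (coh_zero_lift reg ms p_surj pE).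
Qed.

Lemma weak_regular_extend X s : fin_gen X -> weak_regular X s ->
  (forall i, (i <= size s)%N -> coh_zero P i X) ->
  exists2 a, m a & weak_regular X (rcons s a).
Proof.
move=> fgX reg HX.
have [Q [p [p_surj pE]]] := quotient_exists (@seq_span_submodule _ mulC X s).
have [|a ma ra] := regular_element_exists mulC noeR (fin_gen_surj p_surj fgX) mid.
  apply/coh_zero0P; apply: (coh_zero_mod reg p_surj pE (k := 1)) => // i.
  by rewrite addn1; exact: HX.
exists a => //; apply/weak_regular_rcons; split=> // x /pE ax; apply/pE/ra.
by rewrite -linearZ.
Qed.

Lemma weak_regular_exists X n : fin_gen X -> (forall i, (i < n)%N -> coh_zero P i X) ->
  exists s, [/\ weak_regular X s, forall a, a \in s -> m a & size s = n].
Proof.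
move=> fgX; elim: n => [|n IH] HX; first by exists [::].
have [s [reg ms sn]] := IH (fun i ik => HX i (ltnW ik)).
have [|a ma rega] := weak_regular_extend fgX reg; first by rewrite sn.
by exists (rcons s a); rewrite size_rcons sn; split=> //; exact/mem_rcons_sub.
Qed.

Lemma socle_exists X s : weak_regular X s -> (forall a, a \in s -> m a) ->
  ~ coh_zero P (size s) X ->
  exists2 x : X, ~ seq_span s x & forall a, m a -> seq_span s (a *: x).
Proof.
move=> reg ms HX; apply: contrapT => nx; apply: HX.
have [Q [p [p_surj pE]]] := quotient_exists (@seq_span_submodule _ mulC X s).
apply: (coh_zero_lift reg ms p_surj pE (k := 1)) => [[|//] _|]; last by rewrite addn1.
apply/coh_zero0P => q; have [x <-] := p_surj q => mx; apply: contrapT => px.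
apply: nx; exists x; first by move/pE.
by move=> a ma; apply/pE; rewrite linearZ /= mx.
Qed.

Lemma socle_coh X s (x : X) : weak_regular X s -> (forall a, a \in s -> m a) ->
  ~ seq_span s x -> (forall a, m a -> seq_span s (a *: x)) -> ~ coh_zero P (size s) X.
Proof.
move=> reg ms sx mx HX.
have [Q [p [p_surj pE]]] := quotient_exists (@seq_span_submodule _ mulC X s).
have /coh_zero0P HQ : coh_zero P 0 Q.
  apply: (coh_zero_mod reg p_surj pE (k := 1)) => // i.
  rewrite addn1 ltnS leq_eqVlt => /orP[/eqP->//|].
  exact: weak_regular_coh.
apply/sx/pE/HQ => a ma; rewrite -linearZ; apply/pE; exact: mx.
Qed.

(** The socle element of X/sX also witnesses that sX is not X, so full regularity of [s] is obtained
    without Nakayama's lemma. *)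
Lemma depth_coh X n : fin_gen X -> (forall i, (i < n)%N -> coh_zero P i X) ->
  ~ coh_zero P n X -> depth X m = n%:E.
Proof.
move=> fgX HX nX; have [s [reg ms sn]] := weak_regular_exists fgX HX.
have [x sx mx] : exists2 x : X, ~ seq_span s x & forall a, m a -> seq_span s (a *: x).
  by apply: socle_exists => //; rewrite sn.
have max t : regular_seq X t -> (forall a, a \in t -> m a) -> (size t <= n)%N.
  move=> [treg _] mt; rewrite leqNgt; apply/negP => nt; apply: nX.
  exact: (weak_regular_coh treg mt nt).
have ns : exists s, [/\ regular_seq X s, forall a, a \in s -> m a & size s = n].
  by exists s; split=> //; split=> //; exists x.
rewrite /depth; apply: xget_unique; first by exists n.
move=> _ [k [[t [treg mt <-]] tmax] <-]; congr EFin.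
by apply/eqP; rewrite eqn_leq max // -sn; apply: tmax => //; split=> //; exists x.
Qed.

(** If all cohomology vanished, regular sequences in m could always be prolonged. With the ideal (s)
    chosen maximal, the next element [a] lies in (s), and regularity of [a] puts 1 in (s), hence in
    m. *)
Lemma coh_nonzero_exists : ~ m 1 ->
  exists2 d, forall i, (i < d)%N -> coh_zero P i R^o & ~ coh_zero P d R^o.
Proof.
move=> m1; have [d dE] : exists d, ~ coh_zero P d R^o.
  apply: contrapT => nd.
  have HR i : coh_zero P i R^o by apply: contrapT => Hi; apply: nd; exists i.
  have [||_ [s [reg ms] <-] smax] := noetherian_maximal noeR (I0 := @seq_span R R^o [::])
    (F := [set I | exists2 s, weak_regular R^o s /\ (forall a, a \in s -> m a)
                            & @seq_span R R^o s = I]).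
  - by exists [::].
  - by move=> _ [s _ <-]; exact: seq_span_submodule.
  have [a ma rega] := weak_regular_extend (fin_gen_regular R) reg (fun i _ => HR i).
  apply: m1; suff : @seq_span R R^o s 1.
    case=> v ->; case: mid => m0 mD mM; apply: big_ind => // i _.
    rewrite -[_ *: _]/((s`_i : R) * (v i : R)) mulC; apply: mM; apply: ms.
    exact: mem_nth.
  have [_ + ] := (weak_regular_rcons _ _ _).1 rega; apply.
  apply: (smax (@seq_span R R^o (rcons s a))).
  - by exists (rcons s a) => //; split=> //; exact/mem_rcons_sub.
  - move=> x sx; apply/seq_span_rcons; exists x => //; exists 0.
    by rewrite scaler0 addr0.
  - apply/seq_span_rcons; exists 0; first by case: (@seq_span_submodule _ mulC R^o s).
    by exists 1; rewrite add0r.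
have ex : exists d, `[< ~ coh_zero P d R^o >] by exists d; apply/asboolP.
case: (ex_minnP ex) => n /asboolP Hn nmin; exists n => // i ik.
by apply: contrapT => /asboolP /nmin; rewrite leqNgt ik.
Qed.

End Depth.

(** * The Auslander-Bridger formula at a maximal ideal *)

Section ResidueFunctional.
Variables (R : pzRingType) (mulC : forall x y : R, x * y = y * x).
Variables (m : set R) (mid : ideal m) (m1 : ~ m 1).
Hypothesis mmax : forall a, ~ m a -> exists b, m (b * a - 1).
Implicit Types (N Y : lmodType R).

Lemma residue_prime a b : ~ m a -> ~ m b -> ~ m (a * b).
Proof.
move=> ma mb mab; apply: mb; have [c mc] := mmax ma; have [m0 mD mM] := mid.
have -> : b = c * (a * b) + (- b) * (c * a - 1).
  by rewrite mulNr mulrBr mulr1 opprB mulrA [b * _]mulC addrC subrK.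
by apply: mD; apply: mM.
Qed.

Variables (N Y : lmodType R) (r : Y) (r0 : r <> 0) (mr : forall a, m a -> a *: r = 0).

(** No element outside m is a zero divisor on N/G, so N/G embeds in its localisation at m. *)
Definition saturated (G : set N) := forall a x, ~ m a -> G (a *: x) -> G x.

(** Locally at m, N/G is generated by x, with y = (t/a) x. The functional sends y to the residue of
    t/a times [r]; the residue is well defined because G is saturated and x lies outside it. *)
Lemma residue_functional_cyclic (G : set N) x : submodule G -> saturated G -> ~ G x ->
  (forall y, exists a t, ~ m a /\ G (a *: y - t *: x)) ->
  exists f : {linear N -> Y},
    [/\ forall y, G y -> f y = 0, f x <> 0 & forall a y, m a -> a *: f y = 0].
Proof.
move=> Gsub Gsat Gx Gy; have [m0 mD mM] := mid; have [G0 GD GZ] := Gsub.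
have mN a : m a -> m (- a) by move=> ma; rewrite -mulN1r; exact: mM.
(* [c] represents the residue of t/a. *)
pose rel y c := exists a t, [/\ ~ m a, G (a *: y - t *: x) & m (t - a * c)].
have rel_ex y : exists c, rel y c.
  have [a [t [ma Ga]]] := Gy y; have [b mb] := mmax ma.
  exists (b * t), a, t; split=> //.
  have -> : t - a * (b * t) = (- t) * (b * a - 1).
    by rewrite mulNr mulrBr mulr1 opprB mulrA [a * b]mulC [t * _]mulC.
  exact: mM.
have rel_uniq y c c' : rel y c -> rel y c' -> c *: r = c' *: r.
  move=> [a [t [ma Ga mt]]] [a' [t' [ma' Ga' mt']]].
  apply/eqP; rewrite -subr_eq0 -scalerBl; apply/eqP/mr; apply: contrapT => mcc.
  apply: (residue_prime (residue_prime ma ma') mcc).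
  have mtt : m (a' * t - a * t').
    apply: contrapT => mtt; apply: Gx; apply: (Gsat _ _ mtt).
    have -> : (a' * t - a * t') *: x = a *: (a' *: y - t' *: x) - a' *: (a *: y - t *: x).
      by rewrite scalerBl !scalerBr !scalerA [a' * a]mulC opprB [RHS]addrC addrA subrK.
    by apply: submoduleB => //; apply: GZ.
  have -> : a * a' * (c - c') =
      (a' * t - a * t') + ((- a') * (t - a * c) + a * (t' - a' * c')).
    rewrite mulNr !mulrBr !mulrA [a' * a]mulC opprB.
    by rewrite addrA [X in _ = X + _]addrC subrKA subrKA.
  by apply: (mD) => //; apply: mD; apply: mM.
pose c y := projT1 (cid (rel_ex y)).
have cP y : rel y (c y) by exact: projT2 (cid (rel_ex y)).
have f_lin : linear (fun y => c y *: r).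
  move=> e y y'; rewrite scalerA -scalerDl; apply: (rel_uniq _ _ _ (cP _)).
  have [a [t [ma Ga mt]]] := cP y; have [a' [t' [ma' Ga' mt']]] := cP y'.
  have E : a * a' * e = e * a' * a by rewrite mulC [a * a']mulC mulrA.
  exists (a * a'), (e * a' * t + a * t'); split; first exact: residue_prime.
    have -> : (a * a') *: (e *: y + y') - (e * a' * t + a * t') *: x =
        (e * a') *: (a *: y - t *: x) + a *: (a' *: y' - t' *: x).
      by rewrite !scalerBr !scalerA addrACA -opprD -scalerDl scalerDr scalerA E.
    by apply: GD; apply: GZ.
  have -> : e * a' * t + a * t' - a * a' * (e * c y + c y') =
      (e * a') * (t - a * c y) + a * (t' - a' * c y').
    by rewrite !mulrBr !mulrA addrACA -opprD mulrDr !mulrA E.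
  by apply: mD; apply: mM.
exists (mklin f_lin); split=> /=.
- move=> y Gy0; rewrite (@rel_uniq y (c y) 0) ?scale0r //.
  exists 1, 0; split=> //; first by rewrite scale0r subr0 scale1r.
  by rewrite mulr0 subr0.
- rewrite (@rel_uniq x (c x) 1) ?scale1r //.
  by exists 1, 1; split=> //; rewrite ?mulr1 subrr.
- by move=> a y ma; rewrite scalerA mulC -scalerA mr // scaler0.
Qed.

(** Induction on the number of generators: [G1] is the saturation of G + Rz for the last generator
    [z]. If it is proper, one generator has been removed; if not, N/G is locally generated by [z]
    and the cyclic case applies. *)
Lemma residue_functional n (x : 'I_n -> N) (G : set N) : submodule G -> saturated G ->
  ~ (forall y, G y) ->
  (forall y, exists a c, ~ m a /\ G (a *: y - \sum_(i < n) c i *: x i)) ->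
  exists f : {linear N -> Y},
    [/\ forall y, G y -> f y = 0, exists y, f y <> 0 & forall a y, m a -> a *: f y = 0].
Proof.
have [m0 mD mM] := mid.
elim: n x G => [|n IH] x G Gsub Gsat GN Gx.
  case: GN => y; have [a [c [ma]]] := Gx y.
  by rewrite big_ord0 subr0; exact: Gsat.
have [G0 GD GZ] := Gsub; pose z := x ord_max.
pose G1 := [set y | exists a t, ~ m a /\ G (a *: y - t *: z)].
have GG1 y : G y -> G1 y.
  by move=> Gy; exists 1, 0; split=> //; rewrite scale1r scale0r subr0.
have [allG1|nG1] := pselect (forall y, G1 y).
  (* [z] must lie outside G, since otherwise saturation would give G = N. *)
  have [Gz|Gz] := pselect (G z); last first.
    have [f [fG fz fm]] := residue_functional_cyclic Gsub Gsat Gz allG1.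
    by exists f; split=> //; exists z.
  case: GN => y; have [a [t [ma Ga]]] := allG1 y; apply: (Gsat _ _ ma).
  by rewrite -[a *: y](subrK (t *: z)); apply: GD => //; exact: GZ.
have G1sub : submodule G1.
  split=> [|y y' [a [t [ma Ga]]] [a' [t' [ma' Ga']]]|b y [a [t [ma Ga]]]].
  - exact: GG1.
  - exists (a * a'), (a' * t + a * t'); split; first exact: residue_prime.
    have := GD _ _ (GZ a' _ Ga) (GZ a _ Ga').
    by rewrite !scalerBr !scalerA addrACA [a' * a]mulC -scalerDr -opprD -scalerDl.
  - exists a, (b * t); split=> //; have := GZ b _ Ga.
    by rewrite scalerBr !scalerA [b * a]mulC.
have [|y|f [fG fN fm]] := IH (fun i => x (widen_ord (leqnSn n) i)) G1 G1sub _ nG1.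
- move=> a y ma [b [t [mb Gb]]]; exists (b * a), t; split; first exact: residue_prime.
  by rewrite -scalerA.
- have [a [c [ma]]] := Gx y; rewrite big_ord_recr /= => Gc.
  exists a, (fun i => c (widen_ord (leqnSn n) i)); split=> //.
  by exists 1, (c ord_max); split=> //; rewrite scale1r -addrA -opprD.
by exists f; split=> // y /GG1; exact: fG.
Qed.

(** Plays the role of Nakayama's lemma at m: if N and N0 differ after localisation, N/N0 maps
    nontrivially to the copy of R/m spanned by [r]. The saturation of N0 is the starting G. *)
Lemma residue_functional_exists (N0 : set N) : fin_gen N -> submodule N0 ->
  (exists x, forall a, ~ m a -> ~ N0 (a *: x)) ->
  exists f : {linear N -> Y},
    [/\ forall y, N0 y -> f y = 0, exists y, f y <> 0 & forall a y, m a -> a *: f y = 0].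
Proof.
move=> [n [x xN]] N0sub [y ny]; have [N00 N0D N0Z] := N0sub.
pose G := [set y | exists2 a, ~ m a & N0 (a *: y)].
have N0G z : N0 z -> G z by move=> Nz; exists 1; rewrite ?scale1r.
have [||||f [fG fN fm]] := residue_functional (G := G) (x := x).
- split=> [|z z' [a ma Na] [a' ma' Na']|b z [a ma Na]].
  + exact: N0G.
  + exists (a * a'); first exact: residue_prime.
    rewrite scalerDr; apply: N0D; last by rewrite -scalerA; exact: N0Z.
    by rewrite mulC -scalerA; exact: N0Z.
  + by exists a => //; rewrite scalerA mulC -scalerA; exact: N0Z.
- move=> a z ma [b mb Nb]; exists (b * a); first exact: residue_prime.
  by rewrite -scalerA.
- by move=> allG; have [a ma Na] := allG y; exact: ny ma Na.
- move=> z; have [c ->] := xN z; exists 1, c; split=> //.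
  by rewrite scale1r subrr; exact: N0G.
by exists f; split=> // z /N0G; exact: fG.
Qed.

End ResidueFunctional.

(** * Modules of G-dimension zero modulo a regular sequence *)

Section GorensteinZeroRegular.
Variables (R : pzRingType) (mulC : forall x y : R, x * y = y * x).
Hypothesis noeR : noetherian R.
Implicit Types s : seq R.

Lemma seq_span_conv s (x : R) :
  @seq_span R^c (R^c)^o s x <-> @seq_span R R^o s x.
Proof.
split=> -[v ->]; exists v; apply: eq_bigr => i _.
  exact: (mulC (v i : R) (s`_i : R)).
exact: (mulC (s`_i : R) (v i : R)).
Qed.

Lemma weak_regular_conv s : weak_regular R^o s <-> weak_regular (R^c)^o s.
Proof.
have E (a x : R) : (a : R^c) *: (x : (R^c)^o) = a *: (x : R^o) by exact: (mulC x a).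
split=> reg i is_ x /seq_span_conv sx; apply/seq_span_conv; apply: reg => //.
  by rewrite -E.
by rewrite E.
Qed.

(** The obstruction to lifting along [p] lies in Ext^1(X, A). *)
Lemma coh_zero_extend (X A B C : lmodType R) (P : resolution X) (i : {linear A -> B})
    (p : {linear B -> C}) : (forall k, projective (P k)) -> short_exact i p ->
  coh_zero P 1 A -> forall f : {linear X -> C},
  exists g : {linear X -> B}, forall x, p (g x) = f x.
Proof.
move=> Pproj [i_inj p_surj ipE] HA f.
have [g gE] := Pproj 0%N _ _ p (f \o res_aug P)%FUN p_surj.
have [z|h hE] := @lin_factor _ _ _ _ i (g \o res_diff P 0%N)%FUN i_inj.
  by apply/ipE; rewrite /= gE /= res_aug_d linear0.
have [z|w wE] := HA h; first by apply: i_inj; rewrite hE /= res_dd !linear0.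
have [y|e eE] := lin_descend (f := (g \- (i \o w))%FUN : {linear _ -> _}) (res_aug_surj P).
  by move=> /res_exact0[z <-]; rewrite /= -wE hE subrr.
exists e => x; have [y <-] := res_aug_surj P x.
rewrite eE /= linearB gE /=; have -> : p (i (w y)) = 0 by apply/ipE; exists (w y).
by rewrite subr0.
Qed.

End GorensteinZeroRegular.

Section GorensteinZeroModSequence.
Variables (R : pzRingType) (mulC : forall x y : R, x * y = y * x).
Hypothesis noeR : noetherian R.
Variables (G : lmodType R) (G0 : Gdim_zero G).
Implicit Types s : seq R.

(* With N = G^*, G / sG is identified with Hom(N, R / sR), and s is G-regular. *)
Lemma Gdim_zero_mod s : weak_regular R^o s ->
  [/\ forall (Y : lmodType R^c) (p : {linear (R^c)^o -> Y}),
        (forall y, exists x, p x = y) -> (forall x, p x = 0 <-> @seq_span R R^o s x) ->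
        forall f : {linear dual G -> Y}, exists z, forall n, f n = p (dual_app n z),
      forall z, (forall n : dual G, @seq_span R R^o s (dual_app n z)) -> seq_span s z
    & weak_regular G s].
Proof.
case: G0 => fgG /reflexiveP[G_inj G_surj] _ GsR.
have cC := conv_mulC mulC.
have [P Pproj] :=
  projective_resolution_exists (conv_noetherian mulC noeR) (fin_gen_dual mulC noeR fgG).
(* With N the dual of G, the induction also carries the vanishing of Ext^k(N, R/sR) for k > 0, which
   is what lifts maps N -> R/(s,a)R to R/sR. *)
move=> reg; suff : [/\ forall (Y : lmodType R^c) (p : {linear (R^c)^o -> Y}),
        (forall y, exists x, p x = y) -> (forall x, p x = 0 <-> @seq_span R R^o s x) ->
        (forall k, coh_zero P k.+1 Y) /\
        forall f : {linear dual G -> Y}, exists z, forall n, f n = p (dual_app n z),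
      forall z, (forall n : dual G, @seq_span R R^o s (dual_app n z)) -> seq_span s z
    & weak_regular G s].
  by case=> H ? ?; split=> // Y p ps pE f; have [_] := H Y p ps pE; apply.
elim/last_ind: s reg => [|s a IH] reg.
  split=> // [Y p p_surj pE|z zn].
    have p_inj : injective p.
      move=> x y xy; apply/eqP; rewrite -subr_eq0; apply/eqP/(@seq_span_nil R R^o)/pE.
      by rewrite linearB xy subrr.
    have [x|q qE] := lin_descend (f := idfun : {linear (R^c)^o -> (R^c)^o}) p_surj.
      by move/pE/(@seq_span_nil R R^o).
    have pq y : p (q y) = y by have [x <-] := p_surj y; rewrite qE.
    split=> [k|f].
      apply: (coh_zero_iso (p := q)); last exact: (GsR k.+1 isT P Pproj).
        by move=> x; exists (p x).
      by move=> x y xy; rewrite -(pq x) xy pq.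
    have [z zE] := G_surj (q \o f)%FUN; exists z => n.
    by rewrite -[LHS]pq; congr (p _); exact: zE.
  by apply/seq_span_nil/G_inj => n; apply/(@seq_span_nil R R^o); exact: zn.
have /weak_regular_rcons[regs rega] := reg.
have [IHY IHz IHreg] := IH regs.
have /weak_regular_conv : weak_regular R^o (rcons s a) by [].
move=> /(_ mulC) /weak_regular_rcons[_ rega'].
have [Q [p [p_surj pE']]] := quotient_exists (@seq_span_submodule _ cC (R^c)^o s).
have pE x : p x = 0 <-> @seq_span R R^o s x.
  by apply: (iff_trans (pE' x)); exact: seq_span_conv.
have [HQ fQ] := IHY Q p p_surj pE.
split=> [Y p' p'_surj p'E|z zn|].
- have p'E' x : p' x = 0 <-> @seq_span R^c (R^c)^o (rcons s a) x.
    by apply: (iff_trans (p'E x)); apply: iff_sym; exact: seq_span_conv.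
  have [pi [aex piE]] := short_exact_span cC p_surj pE' p'_surj p'E' rega'.
  split=> [k|f]; first exact: (coh_zero_quo Pproj aex).
  have [g gE] := coh_zero_extend Pproj aex (HQ 0%N) f.
  by have [z zE] := fQ g; exists z => n; rewrite -gE zE piE.
(* The map n to p(n(z)) has values in a(R/sR). Dividing it by [a] gives evaluation at some [w], and
   z - a w then evaluates into sR. *)
- have ev_lin : linear (fun n : dual G => p (dual_app n z)).
    by move=> b n n'; rewrite -linearP.
  have [Y [p' [p'_surj p'E]]] := quotient_exists (@seq_span_submodule _ cC (R^c)^o (rcons s a)).
  have [pi [aex piE]] := short_exact_span cC p_surj pE' p'_surj p'E rega'.
  have [a_inj _ aE] := aex.
  have [n|h hE] := @lin_factor _ _ _ _ _ (mklin ev_lin) a_inj.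
    apply/aE; rewrite /= piE; apply/p'E/seq_span_conv => //; exact: zn.
  have [w wE] := fQ h.
  have sz : seq_span s (z - a *: w).
    apply: IHz => n; apply/pE; rewrite /dual_app linearB linearZ /=.
    have /= := hE n; rewrite wE => E.
    have <- : p (n z - (a : R^c) *: (n w : (R^c)^o)) = 0.
      by rewrite linearB linearZ /= E subrr.
    congr (p (_ - _)); exact: (mulC (a : R) (n w)).
  by apply/seq_span_rcons; exists (z - a *: w) => //; exists w; rewrite subrK.
- apply/weak_regular_rcons; split=> // z az; apply: IHz => n; apply: rega.
  have := seq_span_linear (n : {linear G -> R^o}) az; by rewrite linearZ.
Qed.

End GorensteinZeroModSequence.

Section AuslanderBridger.
Variables (R : pzRingType) (mulC : forall x y : R, x * y = y * x).
Hypothesis noeR : noetherian R.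
Variables (m : set R) (mid : ideal m) (m1 : ~ m 1).
Hypothesis mmax : forall a, ~ m a -> exists b, m (b * a - 1).
Variables (kappa : lmodType R) (u : kappa) (P : resolution kappa).
Hypotheses (kappa_gen : forall x : kappa, exists a, a *: u = x)
  (kappa_ann : forall a, a *: u = 0 <-> m a).
Hypothesis Pproj : forall i, projective (P i).
Variable d : nat.
Hypotheses (d_zero : forall i, (i < d)%N -> coh_zero P i R^o)
  (d_nonzero : ~ coh_zero P d R^o).
Implicit Types (X Y A B C G K : lmodType R).

Local Notation wr_coh := (weak_regular_coh mulC kappa_gen kappa_ann Pproj).
Local Notation wr_exists := (weak_regular_exists mulC noeR mid kappa_gen kappa_ann Pproj).

Lemma fin_gen_pair A B : fin_gen A -> fin_gen B -> fin_gen (A * B)%type.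
Proof.
move=> /fin_genP[n [x xA]] /fin_genP[k [y yB]].
have f_lin : linear (fun v : 'rV[R]_(n + k) => (comb x (lsubmx v), comb y (rsubmx v))).
  move=> a v w; apply: injective_projections; rewrite /= linearP.
    exact: comb_linear.
  exact: comb_linear.
apply: (fin_gen_surj (p := mklin f_lin)) => [[a b]|].
  have [v vE] := xA a; have [w wE] := yB b; exists (row_mx v w).
  by rewrite /= row_mxKl row_mxKr vE wE.
by exists (n + k)%N, (delta_mx 0) => v; exists (v 0); exact: row_sum_delta.
Qed.

(* As s is maximal, R/sR contains a copy of R/m, spanned by r. *)
Lemma maximal_regular_sequence s : weak_regular R^o s -> (forall a, a \in s -> m a) ->
  size s = d -> exists (Y : lmodType R^c) (p : {linear (R^c)^o -> Y}) (r : Y),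
    [/\ forall y, exists x, p x = y, forall x, p x = 0 <-> @seq_span R R^o s x,
        r <> 0 & forall a : R^c, m a -> a *: r = 0].
Proof.
move=> reg ms sd; have cC := conv_mulC mulC.
have [x sx mx] : exists2 x : R^o, ~ seq_span s x & forall a, m a -> seq_span s (a *: x).
  by apply: (socle_exists mulC kappa_gen kappa_ann Pproj) => //; rewrite sd.
have [Y [p [p_surj pE]]] := quotient_exists (@seq_span_submodule _ cC (R^c)^o s).
exists Y, p, (p x); split=> // [y|px|a ma].
- by apply: (iff_trans (pE y)); exact: seq_span_conv.
- by apply: sx; apply/(seq_span_conv mulC)/pE.
- rewrite -linearZ; apply/pE/(seq_span_conv mulC).
  by have := mx a ma; rewrite [_ *: _]mulC.
Qed.

Lemma conv_ideal : @ideal R^c m.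
Proof.
have [m0 mD mM] := mid; split=> // a x mx.
by rewrite -[a * x]/((x : R) * (a : R)) mulC; exact: mM.
Qed.

Lemma conv_max (a : R^c) : ~ m a -> exists b : R^c, m (b * a - 1).
Proof.
move=> /mmax[b mb]; exists (b : R^c).
have -> : (b : R^c) * a = ((b : R) * (a : R) : R) by exact: mulC.
exact: mb.
Qed.

Lemma Gdim_zero_coh G : Gdim_zero G -> forall i, (i < d)%N -> coh_zero P i G.
Proof.
move=> G0 i id; have [s [reg ms sd]] := wr_exists (fin_gen_regular R) d_zero.
have [_ _ regG] := Gdim_zero_mod mulC noeR G0 reg.
by apply: (wr_coh regG ms); rewrite sd.
Qed.

(** A nonzero functional on the dual of G with values in R/sR killed by m is evaluation at some [z],
    which is then a nonzero socle element of G/sG. *)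
Lemma Gdim_zero_coh_nonzero G : Gdim_zero G ->
  (exists x : G, forall a, ~ m a -> a *: x <> 0) -> ~ coh_zero P d G.
Proof.
move=> G0 [x0 x0m]; have [s [reg ms sd]] := wr_exists (fin_gen_regular R) d_zero.
have [fGY zG regG] := Gdim_zero_mod mulC noeR G0 reg.
have [Y [p [r [p_surj pE r0 mr]]]] := maximal_regular_sequence reg ms sd.
have fgN : fin_gen (dual G) by case: G0 => fgG _ _ _; exact: fin_gen_dual.
have cC := conv_mulC mulC.
have N0sub : submodule [set n : dual G | n = 0].
  by split=> [|_ _ -> ->|a _ ->] //=; rewrite ?addr0 ?scaler0.
have [|f [_ [n0 fn0] fm]] := residue_functional_exists cC conv_ideal m1 conv_max r0 mr fgN N0sub.
  (* Otherwise a single [c] outside m kills the finitely generated dual of G, and then c x0 = 0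
     because functionals separate the points of G. *)
  apply: contrapT => tors.
  have torsN (n : dual G) : exists2 a, ~ m a & (a : R^c) *: n = 0.
    apply: contrapT => na; apply: tors; exists n => a ma an; apply: na; by exists a.
  have [k [y yN]] := fgN.
  have /choice[b bE] (i : 'I_k) : exists a, ~ m a /\ (a : R^c) *: y i = 0.
    by have [a ma an] := torsN (y i); exists a.
  have [c mc cN] : exists2 c : R^c, ~ m c & forall i, c *: y i = 0.
    have [c mc cN] : exists2 c : R^c, ~ m c & forall i, i \in enum 'I_k -> c *: y i = 0.
      elim: (enum 'I_k) => [|i t [c mc ct]]; first by exists 1.
      exists (c * b i); first by apply: (residue_prime cC conv_ideal conv_max) => //; case: (bE i).
      move=> j; rewrite inE => /orP[/eqP->|jt].
        by rewrite -scalerA; case: (bE i) => _ ->; rewrite scaler0.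
      by rewrite cC -scalerA ct // scaler0.
    by exists c => // i; apply: cN; rewrite mem_enum.
  apply: (x0m c mc); case: G0 => _ /reflexiveP[G_inj _] _ _; apply: G_inj => n.
  have cn : (c : R^c) *: n = 0.
    have [e ->] := yN n; rewrite scaler_sumr big1 // => i _.
    by rewrite scalerA cC -scalerA cN scaler0.
  rewrite /dual_app linearZ /= -[_ *: _]/((c : R) * dual_app n x0) mulC.
  exact: (congr1 (fun n => dual_app n x0) cn).
have [z zE] := fGY Y p p_surj pE f.
apply: (eq_ind (size s) (fun k => ~ coh_zero P k G)) sd.
apply: (socle_coh mulC kappa_gen kappa_ann Pproj (x := z)) => //.
  move=> sz; apply: fn0; rewrite zE; apply/pE.
  exact: (seq_span_linear (n0 : {linear G -> R^o})).
move=> a ma; apply: zG => n; apply/pE.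
have := fm a n ma; rewrite zE -linearZ => <-; congr (p _).
by rewrite /dual_app linearZ; exact: mulC.
Qed.

(** The hypothesis on [f] expresses that Ext^1(X, R)_m is nonzero; it provides a nonzero functional
    on the dual of K that vanishes on the functionals extending to G. *)
Lemma Gdim_one_coh K G X (i : {linear K -> G}) (p : {linear G -> X}) :
  short_exact i p -> Gdim_zero K -> Gdim_zero G ->
  (exists f : {linear K -> R^o}, forall a, ~ m a ->
     ~ exists g : {linear G -> R^o}, forall x, a *: f x = g (i x)) ->
  [/\ (0 < d)%N, forall i, (i < d.-1)%N -> coh_zero P i X & ~ coh_zero P d.-1 X].
Proof.
move=> ip K0 G0 [f fS].
have fgX : fin_gen X.
  by case: ip => _ p_surj _; case: G0 => fgG _ _ _; exact: fin_gen_surj p_surj fgG.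
have nX : ~ forall i, (i < d)%N -> coh_zero P i X.
  move=> HX; have := wr_exists (fin_gen_pair (fin_gen_regular R) fgX)
    (fun j jd => coh_zero_pair (d_zero jd) (HX j jd)).
  move=> [s [/weak_regular_pair[//|reg regX] ms sd]].
  have [Y [q [r [q_surj qE r0 mr]]]] := maximal_regular_sequence reg ms sd.
  have [fKY zK _] := Gdim_zero_mod mulC noeR K0 reg.
  have [_ zG _] := Gdim_zero_mod mulC noeR G0 reg.
  have fgN : fin_gen (dual K) by case: K0 => fgK _ _ _; exact: fin_gen_dual.
  have [|h [h0 [n0 hn0] _]] := residue_functional_exists (conv_mulC mulC) conv_ideal m1
      conv_max r0 mr fgN (range_submodule (dual_map i)).
    exists (f : dual K) => a ma [g gE]; apply: (fS a ma).
    exists (g : {linear G -> R^o}) => x.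
    rewrite -[_ *: _]/((a : R) * f x) mulC.
    exact/esym/(congr1 (fun n => dual_app n x) gE).
  have [z zE] := fKY Y q q_surj qE h.
  have : seq_span s (i z).
    apply: zG => n; apply/qE; rewrite -[dual_app n (i z)]/(dual_app (dual_map i n) z) -zE.
    by apply: h0; exists n.
  move/(seq_span_exact mulC ip regX) => sz; apply: hn0; rewrite zE; apply/qE.
  exact: (seq_span_linear (n0 : {linear K -> R^o})).
have d0 : (0 < d)%N by rewrite lt0n; apply/eqP => d0; apply: nX => j; rewrite d0.
have HX j : (j < d.-1)%N -> coh_zero P j X.
  move=> jd; have jd' : (j.+1 < d)%N by rewrite -(prednK d0).
  by apply: (coh_zero_quo Pproj ip); apply: Gdim_zero_coh => //; exact: ltnW.
(* Vanishing in degree d - 1 as well would give vanishing everywhere below d, which [nX]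
   excludes. *)
split=> // Hd; apply: nX => j; rewrite -[in (_ < d)%N](prednK d0) ltnS leq_eqVlt.
by case/orP => [/eqP->|/HX].
Qed.

(** Non-vanishing at m passes from X to its syzygy K one degree lower. On the way back the first
    non-vanishing degree drops by one, because the cohomology of G vanishes below d. *)
Lemma Gres_coh n X (Q : resolution X) : (forall k, projective (Q k)) -> Gres n.+1 X ->
  ~ coh_torsion [set a | ~ m a] Q n R^o ->
  [/\ (n < d)%N, forall i, (i < d - n.+1)%N -> coh_zero P i X
    & ~ coh_zero P (d - n.+1) X].
Proof.
elim: n X Q => [|n IH] X Q Qproj /= [K [G [i [p [ip G0 KG]]]]] tors.
  have [fgK _ _ _] := KG; have [PK PKproj] := projective_resolution_exists noeR fgK.
  rewrite subn1; apply: (Gdim_one_coh ip KG G0); apply: contrapT => nf; apply: tors.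
  apply: (Ext_torsion_right0 mulC ip PKproj Qproj); first by case: G0 => _ _ + _; apply.
  move=> f; apply: contrapT => fa; apply: nf; exists f => a ma [g gE]; apply: fa.
  by exists a => //; exists g.
have fgK := Gres_fin_gen (n := n.+1) KG.
have [PK PKproj] := projective_resolution_exists noeR fgK.
have [|nd HK nK] := IH K PK PKproj KG.
  move=> HPK; apply: tors.
  by apply: (Ext_torsion_right mulC ip PKproj Qproj) => //; case: G0 => _ _ + _; apply.
have GH := Gdim_zero_coh G0.
(* If d = n + 1, then H^0(K) would be nonzero; but K embeds in G, and H^0(G) = 0 since d > 0. *)
have nd' : (n.+1 < d)%N.
  rewrite ltn_neqAle nd andbT; apply/eqP => dn; apply: nK; rewrite dn subnn.
  have /(coh_zero0P P kappa_gen kappa_ann) GH0 : coh_zero P 0 G by apply: GH; rewrite -dn.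
  apply/(coh_zero0P P kappa_gen kappa_ann) => y my.
  have [i_inj _ _] := ip; apply: i_inj; rewrite linear0; apply: GH0 => a ma.
  by rewrite -linearZ /= my // linear0.
have dE : (d - n.+1 = (d - n.+2).+1)%N by rewrite -subSn.
split=> // [j jd|HX].
  apply: (coh_zero_quo Pproj ip); first by apply: GH; apply: leq_trans jd (leq_subr _ _).
  by apply: HK; rewrite dE ltnS.
apply: nK; rewrite dE; apply: (coh_zero_subS Pproj ip HX); apply: GH.
by rewrite -dE ltn_subrL /= (leq_ltn_trans _ nd).
Qed.

End AuslanderBridger.

(** * Gradings *)

Section Gradings.
Variables (R : pzRingType) (mulC : forall x y : R, x * y = y * x).
Hypothesis noeR : noetherian R.
Implicit Types (X Y : lmodType R) (n r : nat).

(* [pi p] is the projection on the component of degree p; [rho] plays the same role for R. *)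
Definition grading (rho : int -> R -> R) Y (pi : int -> Y -> Y) :=
  [/\ forall p x y, pi p (x + y) = pi p x + pi p y,
      forall y, exists s : seq int, forall t, uniq t -> {subset s <= t} ->
        y = \sum_(p <- t) pi p y,
      forall p q y, pi p (pi q y) = if p == q then pi p y else 0
    & forall p q a y, pi (p + q) (rho p a *: y) = rho p a *: pi q y].

Variable rho : int -> R -> R.
Hypothesis rhoG : grading rho (rho : int -> R^o -> R^o).

Section Module.
Variables (Y : lmodType R) (pi : int -> Y -> Y) (piG : grading rho pi).

Lemma grading0 p : pi p 0 = 0.
Proof. by case: piG => piD _ _ _; apply: (@addIr _ (pi p 0)); rewrite -piD !add0r. Qed.

Lemma gradingB p x y : pi p (x - y) = pi p x - pi p y.
Proof. by case: piG => piD _ _ _; apply: (@addIr _ (pi p y)); rewrite -piD !subrK. Qed.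

Lemma grading_sum p I (t : seq I) (F : I -> Y) :
  pi p (\sum_(i <- t) F i) = \sum_(i <- t) pi p (F i).
Proof.
case: piG => piD _ _ _; elim: t => [|i t IH]; first by rewrite !big_nil grading0.
by rewrite !big_cons piD IH.
Qed.

Lemma grading_scale_homog p e a (y : Y) : pi e y = y ->
  pi p (a *: y) = rho (p - e) a *: y.
Proof.
move=> ye; have [rhoD rhoS rhoI rhoZ] := rhoG; have [piD piS piI piZ] := piG.
have [s sE] := rhoS a; pose t := undup (p - e :: s).
have tu : uniq t by exact: undup_uniq.
have st : {subset s <= t} by move=> q qs; rewrite mem_undup inE qs orbT.
have pet : p - e \in t by rewrite mem_undup inE eqxx.
have E q : pi p (rho q a *: y) = if q == p - e then rho q a *: y else 0.
  rewrite -[in LHS](subrK q p) [p - q + q]addrC piZ -[in LHS]ye piI.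
  have -> : (p - q == e) = (q == p - e).
    by rewrite subr_eq [RHS]eq_sym subr_eq addrC.
  case: eqP => [->|_]; last by rewrite scaler0.
  by have -> : p - (p - e) = e by [rewrite opprB addrC subrK]; rewrite ye.
rewrite [in LHS](sE t tu st) scaler_suml grading_sum (bigD1_seq (p - e)) //= E eqxx.
by rewrite big1 ?addr0 // => q /negbTE qp; rewrite E qp.
Qed.

Section Shift.
Variables (n : nat) (e : 'I_n -> int).

(** Grading of the free module whose k-th basis vector has degree [e k]. *)
Definition shift_pi p (v : 'rV[R]_n) := \row_k rho (p - e k) (v 0 k).

Lemma shift_grading : grading rho shift_pi.
Proof.
have [rhoD rhoS rhoI rhoZ] := rhoG; split=> [p v w|v|p q v|p q a v].
- by apply/rowP => k; rewrite !mxE rhoD.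
- have [s sE] := choice (fun k => rhoS (v 0 k)).
  exists (flatten [seq [seq p + e k | p <- s k] | k <- enum 'I_n]) => t tu st.
  apply/rowP => k; rewrite summxE.
  have -> : \sum_(p <- t) (shift_pi p v) 0 k = \sum_(q <- [seq p - e k | p <- t]) rho q (v 0 k).
    by rewrite big_map; apply: eq_bigr => p _; rewrite mxE.
  apply: sE; first by rewrite map_inj_uniq //; exact: addIr.
  move=> q qs; apply/mapP; exists (q + e k); last by rewrite addrK.
  apply/st/flattenP; exists [seq p + e k | p <- s k]; last exact: map_f.
  by apply/mapP; exists k; rewrite ?mem_enum.
- apply/rowP => k; rewrite !mxE rhoI.
  have -> : (p - e k == q - e k) = (p == q) by rewrite (inj_eq (addIr _)).
  by case: eqP; rewrite !mxE.
- apply/rowP => k; rewrite !mxE -addrA; exact: (rhoZ p (q - e k) a (v 0 k)).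
Qed.

Lemma grading_comb (y : 'I_n -> Y) p v : (forall k, pi (e k) (y k) = y k) ->
  pi p (comb y v) = comb y (shift_pi p v).
Proof.
move=> ye; rewrite /comb grading_sum; apply: eq_bigr => k _.
by rewrite (grading_scale_homog _ _ (ye k)) mxE.
Qed.

End Shift.

Definition homog_mx r n (e' : 'I_r -> int) (e : 'I_n -> int) (A : 'M[R]_(r, n)) :=
  forall i j, rho (e' i - e j) (A i j) = A i j.

(** The kernel is stable under homogeneous components, so the components of the rows of [A] generate
    it; the new rows are indexed by pairs of a row and a degree. *)
Lemma graded_kernel n (e : 'I_n -> int) (y : 'I_n -> Y) :
  (forall k, pi (e k) (y k) = y k) ->
  exists r e' (A : 'M[R]_(r, n)), homog_mx e' e A /\
    forall v, comb y v = 0 <-> exists w : 'rV[R]_r, v = w *m A.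
Proof.
move=> ye; have [rhoD rhoS rhoI rhoZ] := rhoG.
have [|r [A AE]] := noetherian_submodule noeR (N := [set v | comb y v = 0]).
  exact: (ker_submodule (mklin (comb_linear y))).
have [eD eS eI eZ] := shift_grading e.
have [s sE] := choice (fun k => eS (row k A)).
pose t := undup (flatten [seq s k | k <- enum 'I_r]).
have tE k : row k A = \sum_(p <- t) shift_pi e p (row k A).
  apply: sE; first exact: undup_uniq.
  move=> p ps; rewrite mem_undup; apply/flattenP; exists (s k) => //.
  by apply/mapP; exists k; rewrite ?mem_enum.
pose T : finType := ('I_r * 'I_(size t))%type.
pose e' (i : 'I_#|T|) := t`_(enum_val i).2.
pose b (u : T) : 'rV[R]_n := shift_pi e t`_u.2 (row u.1 A).
pose B : 'M[R]_(#|T|, n) := \matrix_i b (enum_val i).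
have yA k : comb y (row k A) = 0.
  by apply/AE; exists (delta_mx 0 k); rewrite rowE.
exists #|T|, e', B; split=> [i j|v].
  by rewrite !mxE rhoI eqxx.
split=> [/AE[w ->]|[w ->]]; last first.
  rewrite comb_mul; apply: big1 => i _; rewrite rowK /b -grading_comb // yA.
  by rewrite grading0 scaler0.
(* Each row is the sum of its components, so its coefficient is repeated on all of them. *)
exists (\row_i w 0 (enum_val i).1); rewrite !mulmx_sum_row.
under [RHS]eq_bigr => i _ do rewrite rowK mxE.
rewrite -(big_enum_val (fun u : T => w 0 u.1 *: b u)) /=.
rewrite -(pair_bigA _ (fun k l => w 0 k *: b (k, l))) /=.
apply: eq_bigr => k _; rewrite -scaler_sumr; congr (_ *: _).
by rewrite [LHS]tE (big_nth 0) big_mkord.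
Qed.

End Module.

Lemma graded_resolution X (pi : int -> X -> X) n (e : 'I_n -> int) (x : 'I_n -> X) :
  grading rho pi -> (forall k, pi (e k) (x k) = x k) -> (forall z, exists v, comb x v = z) ->
  exists (d : nat -> nat) (ee : forall k, 'I_(d k) -> int)
    (M : forall k, 'M[R]_(d k.+1, d k)) (y : 'I_(d 0%N) -> X),
  [/\ forall k, homog_mx (ee k.+1) (ee k) (M k),
      forall v, comb y v = 0 <-> exists w : 'rV_(d 1%N), v = w *m M 0%N,
      forall k (v : 'rV_(d k.+1)), v *m M k = 0 <-> exists w : 'rV_(d k.+2), v = w *m M k.+1
    & forall z, exists v, comb y v = z].
Proof.
move=> piG xe xX; have [r [e' [A [homA AE]]]] := graded_kernel piG xe.
have [|d [ee [M [y [homM y0 MS yX]]]]] := matrix_resolution _ homA AE.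
  move=> q k f' f B homB.
  have [|t [f'' [C [homC CE]]]] :=
      graded_kernel (shift_grading f) (e := f') (y := fun i => row i B).
    by move=> i; apply/rowP => j; rewrite !mxE homB.
  exists t, f'', C; split=> // v; apply: iff_trans (CE v).
  by rewrite mulmx_sum_row.
by exists d, ee, M, y; split=> //; exact: yX.
Qed.

Section TorsionCocycles.
Variables (m : set R) (X : lmodType R) (d : nat -> nat).
Hypothesis m_top : forall I, ideal I -> (forall p x, I x -> I (rho p x)) -> ~ I 1 -> I `<=` m.
Variables (ee : forall k, 'I_(d k) -> int) (M : forall k, 'M[R]_(d k.+1, d k)).
Variable y : 'I_(d 0%N) -> X.
Hypotheses (homM : forall k, homog_mx (@ee k.+1) (@ee k) (@M k))
  (y_surj : forall z, exists v, comb y v = z)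
  (y_exact : forall v, comb y v = 0 <-> exists w : 'rV_(d 1%N), v = w *m M 0%N)
  (M_exact : forall k (v : 'rV_(d k.+1)),
    v *m M k = 0 <-> exists w : 'rV_(d k.+2), v = w *m M k.+1).

Definition cobound k (G : 'I_(d k) -> R^o) (l : 'I_(d k.+1)) : R^o := comb G (row l (M k)).

(** Component of degree p of a cochain: the j-th basis vector has degree [ee j], so its value must
    have degree p + [ee j]. *)
Definition degree_part k p (G : 'I_(d k) -> R^o) j : R^o := rho (p + ee j) (G j).

Lemma cobound_degree_part k p (G : 'I_(d k) -> R^o) l :
  degree_part p (cobound G) l = cobound (degree_part p G) l.
Proof.
have [rhoD rhoS rhoI rhoZ] := rhoG; rewrite /degree_part /cobound /comb.
rewrite (grading_sum rhoG); apply: eq_bigr => j _; rewrite !mxE -homM -rhoZ.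
by congr (rho _ _); rewrite [RHS]addrCA subrK.
Qed.

Lemma cobound_linear k (G H : 'I_(d k) -> R^o) (a : R) l :
  cobound (fun j => a *: G j + H j) l = a *: cobound G l + cobound H l.
Proof.
rewrite /cobound /comb scaler_sumr -big_split; apply: eq_bigr => j _.
by rewrite scalerDr !scalerA mulC.
Qed.

Let bounds k (F : 'I_(d k.+1) -> R^o) := exists G, forall l, F l = cobound G l :> R^o.

(* The annihilator of a homogeneous class is a graded ideal. *)
Lemma bounds_homog k p (F : 'I_(d k.+1) -> R^o) : (forall l, rho (p + ee l) (F l) = F l) ->
  (exists2 a, ~ m a & bounds (fun l => a *: F l)) -> bounds F.
Proof.
move=> Fp [a ma Fa]; pose I := [set b : R | bounds (fun l => b *: F l)].
have [I1|I1] := pselect (I 1).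
  by have [G GE] := I1; exists G => l; rewrite -GE scale1r.
case: ma; apply: (m_top _ _ I1 Fa) => [|q b [G GE]].
  split=> [|b c [G GE] [H HE]|b c [G GE]].
  - exists (fun=> 0) => l; rewrite scale0r /cobound /comb big1 // => j _.
    by rewrite scaler0.
  - exists (fun j => 1 *: G j + H j) => l.
    by rewrite cobound_linear -GE -HE scale1r scalerDl.
  - exists (fun j => b *: G j + 0) => l; rewrite (cobound_linear G (fun=> 0)).
    rewrite -GE scalerA /cobound [X in _ + X]/comb big1 ?addr0 // => j _.
    by rewrite scaler0.
(* As F has degree p, the component of degree q + p of bF is F times the degree q component of b. *)
exists (degree_part (q + p) G) => l; rewrite -cobound_degree_part /degree_part -GE.
rewrite (grading_scale_homog rhoG _ _ (Fp l)); congr (rho _ _ *: _).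
by rewrite -[q + p + _]addrA addrK.
Qed.

(** Each homogeneous component of a cocycle is again a cocycle and is a coboundary by
    [bounds_homog]; finitely many components add up to the given one. *)
Lemma graded_coh_torsion k :
  coh_torsion [set a | ~ m a] (mxres y_surj y_exact M_exact) k R^o ->
  coh_zero (mxres y_surj y_exact M_exact) k.+1 R^o.
Proof.
move=> tors f fd; have [rhoD rhoS rhoI rhoZ] := rhoG.
pose F l : R^o := f (delta_mx 0 l).
have fF v : f v = comb F v by exact: linear_comb.
have F0 l : cobound F l = 0.
  by rewrite /cobound -fF; have := fd (delta_mx 0 l); rewrite /= -rowE.
have boundsF p : bounds (degree_part p F).
  apply: (@bounds_homog k p) => [l|]; first by rewrite /degree_part rhoI eqxx.
  have [|a ma [g gE]] := tors (mklin (comb_linear (degree_part p F))).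
    move=> z; rewrite /= comb_mul /comb big1 // => l _.
    rewrite -[X in _ *: X]/(cobound (degree_part p F) l) -cobound_degree_part.
    by rewrite /degree_part F0 (grading0 rhoG) scaler0.
  exists a => //; exists (fun j => g (delta_mx 0 j)) => l.
  have /= := gE (delta_mx 0 l); rewrite comb_delta -rowE => ->.
  exact: (linear_comb g).
have [G GE] := choice boundsF.
have [s sE] := choice (fun l => rhoS (F l)).
(* The shift by [ee l] turns degrees of the values [F l] into degrees of cochains. *)
pose t := undup (flatten [seq [seq p - ee l | p <- s l] | l <- enum 'I_(d k.+1)]).
have FE l : F l = \sum_(p <- t) degree_part p F l.
  have -> : \sum_(p <- t) degree_part p F l =
      \sum_(q <- [seq p + ee l | p <- t]) rho q (F l) by rewrite big_map.
  apply: sE; first by rewrite map_inj_uniq ?undup_uniq //; exact: addIr.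
  move=> q qs; apply/mapP; exists (q - ee l); last by rewrite subrK.
  rewrite mem_undup; apply/flattenP; exists [seq p - ee l | p <- s l].
    by apply/mapP; exists l; rewrite ?mem_enum.
  exact: (map_f (fun p => p - ee l)).
exists (mklin (comb_linear (fun j => \sum_(p <- t) G p j))) => v.
rewrite fF /= comb_mul; apply: eq_bigr => l _; congr (_ *: _).
rewrite FE /comb; under [RHS]eq_bigr => j _ do rewrite scaler_sumr.
by rewrite exchange_big; apply: eq_bigr => p _; exact: GE.
Qed.

End TorsionCocycles.

End Gradings.

(** * The associated graded ring and module *)

Section GradedLocal.
Variables (R : pzRingType) (mulC : forall x y : R, x * y = y * x).
Hypothesis noeR : noetherian R.
Variables (rho : int -> R -> R) (rhoG : grading rho (rho : int -> R^o -> R^o)).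
Variable homog : int -> set R.
Hypothesis homogE : forall p x, homog p x <-> rho p x = x.
Variables (m : set R) (mL : star_local homog m).

Lemma graded_idealP I : ideal I ->
  graded_ideal homog I <-> forall p x, I x -> I (rho p x).
Proof.
have [rhoD rhoS rhoI rhoZ] := rhoG => Iid; have [I0 ID IM] := Iid.
split=> [[_ gI] p x /gI[s [sI ->]]|Irho].
  rewrite (grading_sum rhoG); elim: s sI => [|y s IH] sI; first by rewrite big_nil.
  rewrite big_cons; apply: ID; last by apply: IH => z zs; apply: sI; rewrite inE zs orbT.
  have [Iy [q /homogE yq]] := sI y (mem_head _ _).
  by rewrite -yq rhoI; case: eqP => [->|_ //]; rewrite yq.
split=> // x Ix; have [t tE] := rhoS x.
exists [seq rho p x | p <- undup t]; split=> [_ /mapP[p _ ->]|].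
  by split; [exact: Irho|exists p; apply/homogE; rewrite rhoI eqxx].
by rewrite big_map; apply: tE; [exact: undup_uniq|move=> p; rewrite mem_undup].
Qed.

(** By Noetherianity I lies in a maximal proper graded ideal, which is m by uniqueness. *)
Lemma star_local_top I : ideal I -> (forall p x, I x -> I (rho p x)) -> ~ I 1 -> I `<=` m.
Proof.
move=> Iid Irho I1; have [_ muniq] := mL.
have [||J [gJ J1 IJ] Jmax] := noetherian_maximal noeR (I0 := I)
  (F := [set J | [/\ graded_ideal homog J, ~ J 1 & I `<=` J]]).
- by split=> //; apply/graded_idealP.
- by move=> J [[]].
suff <- : J = m by [].
apply: muniq; split=> // K gK K1 JK; apply/seteqP; split=> //.
by apply: Jmax => //; split=> // x /IJ /JK.
Qed.

Hypotheses (rho_neg : forall p x, p < 0 -> rho p x = 0) (rho1 : rho 0 1 = 1).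

Lemma star_local_ideal : ideal m.
Proof. by case: mL => -[[]]. Qed.

Lemma star_local_proper : ~ m 1.
Proof. by case: mL => -[]. Qed.

Lemma star_local_homog p y : rho p y = y -> ~ m y -> exists b, m (b * y - 1).
Proof.
move=> yp my; have [[gm m1 mmax] _] := mL; have mid := star_local_ideal.
have mrho := (graded_idealP mid).1 gm; have [m0 mD mM] := mid.
(* J = m + Ry is graded and strictly larger than m, so it contains 1. *)
pose J := [set x | exists b, m (x - b * y)].
have Jid : ideal J.
  split=> [|x x' [b mb] [b' mb']|a x [b mb]].
  - by exists 0; rewrite mul0r subr0.
  - by exists (b + b'); rewrite mulrDl opprD addrACA; exact: mD.
  - by exists (a * b); rewrite -mulrA -mulrBr; exact: mM.
have Jrho q x : J x -> J (rho q x).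
  move=> [b mb]; exists (rho (q - p) b); have := mrho q _ mb.
  by rewrite (gradingB rhoG) [rho q (b * y)](grading_scale_homog rhoG rhoG q b yp).
have [J1|J1] := pselect (J 1).
  have [b mb] := J1; exists b; rewrite -opprB -mulN1r; exact: mM.
case: my; rewrite -(mmax J) //; first by exists 1; rewrite mul1r subrr.
- exact/graded_idealP.
- by move=> x mx; exists 0; rewrite mul0r subr0.
Qed.

(* R is nonnegatively graded, so m contains all elements of positive degree. *)
Lemma star_local_maximal a : ~ m a -> exists b, m (b * a - 1).
Proof.
move=> ma; have [[gm m1 mmax] _] := mL; have mid := star_local_ideal.
have [rhoD rhoS rhoI rhoZ] := rhoG; have [m0 mD mM] := mid.
have mrho := (graded_idealP mid).1 gm.
(* If x_p were outside m for some p > 0, then b x_p - 1 would lie in m for some b. The degree 0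
   component of b x_p involves b in degree -p, so it is zero, and 1 would lie in m. *)
have mpos p x : p != 0 -> m (rho p x).
  case: (ltgtP p 0) => // p0 _; first by rewrite rho_neg.
  apply: contrapT => nm; have pp : rho p (rho p x) = rho p x by rewrite rhoI eqxx.
  have [b mb] := star_local_homog pp nm; apply: m1.
  have := mrho 0 _ mb; rewrite (gradingB rhoG) rho1.
  rewrite [rho 0 (b * _)](grading_scale_homog rhoG rhoG 0 b pp) sub0r.
  rewrite rho_neg ?oppr_lt0 // scale0r sub0r => /(mM (-1)).
  by rewrite mulN1r opprK.
have [t tE] := rhoS a; pose t0 := undup (0 :: t).
(* Modulo m, [a] equals its degree 0 component, so inverting that homogeneous element suffices. *)
have ma0 : m (a - rho 0 a).
  rewrite {1}(tE t0) ?undup_uniq // => [|p pt]; last by rewrite mem_undup inE pt orbT.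
  rewrite (bigD1_seq 0) ?undup_uniq ?mem_undup ?mem_head //= addrAC subrr add0r.
  by apply: big_ind => // p /mpos.
have nm : ~ m (rho 0 a) by move=> m0a; apply: ma; rewrite -(subrK (rho 0 a) a); exact: mD.
have r0 : rho 0 (rho 0 a) = rho 0 a by rewrite rhoI eqxx.
have [b mb] := star_local_homog r0 nm; exists b.
by rewrite -(subrK (rho 0 a) a) mulrDr -addrA; apply: mD => //; exact: mM.
Qed.

End GradedLocal.

Section GrGrading.
Variables (L : nzRingType) (FL : ring_filtration L).
Local Notation R := (gr FL).

Definition rees_comp_poly (p : int) (a : {poly L}) : {poly L} :=
  \poly_(i < size a) (if i%:Z == p then a`_i else 0).

Lemma coef_rees_comp p a k : (rees_comp_poly p a)`_k = if k%:Z == p then a`_k else 0.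
Proof.
rewrite coef_poly; case: ltnP => // ak.
by rewrite nth_default //; case: eqP.
Qed.

Fact rees_comp_subproof p (a : rees FL) : rees_pred FL (rees_comp_poly p (val a)).
Proof.
apply/asboolP => k; rewrite coef_rees_comp; case: eqP => _; first exact: reesP.
exact: rfil0.
Qed.

Definition rees_comp p (a : rees FL) : rees FL := Sub _ (rees_comp_subproof p a).

Lemma rees_ext (a b : rees FL) : (forall k, (val a)`_k = (val b)`_k) -> a = b.
Proof. by move=> ab; apply/val_inj/polyP. Qed.

Lemma coef_reesM (a b : rees FL) k :
  (val (a * b))`_k = \sum_(i < k.+1) (val a)`_i * (val b)`_(k - i).
Proof. by rewrite rmorphM coefM. Qed.

Lemma coef_reesD (a b : rees FL) k : (val (a + b))`_k = (val a)`_k + (val b)`_k.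
Proof. by rewrite raddfD coefD. Qed.

Definition gr_comp (p : int) (x : R) : R := gr_class (rees_comp p (repr x)).

Lemma gr_compE p a : gr_comp p (gr_class a) = gr_class (rees_comp p a).
Proof.
apply/eqP; rewrite gr_class_eq; apply/asboolP => k.
have /asboolP/(_ k) := gr_repr_class a.
rewrite !raddfB !coefB /= !coef_rees_comp; case: eqP => // _ _.
by rewrite subrr; exact: rfil0.
Qed.

Lemma gr_class_sum I (t : seq I) (F : I -> rees FL) :
  gr_class (\sum_(i <- t) F i) = \sum_(i <- t) gr_class (F i).
Proof. exact: (raddf_sum (\pi_({ideal_quot @rees_ideal L FL}))%qT). Qed.

Lemma gr_grading : grading gr_comp (gr_comp : int -> R^o -> R^o).
Proof.
split=> [p x y|y|p q y|p q a y].
- rewrite -[x]gr_class_repr -[y]gr_class_repr -gr_classD !gr_compE -gr_classD.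
  congr gr_class; apply: rees_ext => k.
  by rewrite !coef_reesD /= !coef_rees_comp coef_reesD; case: eqP; rewrite ?addr0.
- set a := repr y; exists [seq i%:Z | i <- iota 0 (size (val a))] => t tu st.
  rewrite -[LHS]gr_class_repr -gr_class_sum; congr gr_class; apply: rees_ext => k.
  rewrite raddf_sum coef_sum /=; under eq_bigr => p _ do rewrite coef_rees_comp.
  have [kt|kt] := boolP (k%:Z \in t).
    rewrite (bigD1_seq k%:Z) //= eqxx big1 ?addr0 // => p pk.
    by rewrite eq_sym (negbTE pk).
  rewrite big1_seq => [|p /andP[_ pt]]; last by case: eqP => // kp; rewrite kp pt in kt.
  apply: nth_default; rewrite leqNgt; apply: contra kt => ka; apply: st.
  by apply: map_f; rewrite mem_iota.
- rewrite -[y]gr_class_repr !gr_compE.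
  have -> : (if p == q then gr_class (rees_comp p (repr y)) else 0) =
    gr_class (if p == q then rees_comp p (repr y) else 0).
    by case: eqP => // _; exact/esym/(raddf0 (\pi_({ideal_quot @rees_ideal L FL}))%qT).
  congr gr_class; apply: rees_ext => k; rewrite /= !coef_rees_comp /= .
  case: (p =P q) => [<-|pq] /=; rewrite ?coef_rees_comp; first by case: eqP.
  by rewrite coef0; case: eqP => // ->; case: eqP.
- rewrite -[_ *: _]/(gr_mul _ _) -[RHS]/(gr_mul _ _).
  rewrite -[a]gr_class_repr -[y]gr_class_repr.
  rewrite [gr_comp p _]gr_compE [gr_comp q _]gr_compE !gr_mulE gr_compE.
  congr gr_class; apply: rees_ext => k.
  rewrite [RHS]coef_reesM [LHS]coef_rees_comp coef_reesM.
  case: eqP => [kpq|kpq]; last first.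
    rewrite big1 // => i _ /=; rewrite !coef_rees_comp.
    case: eqP => [ip|_]; last by rewrite mul0r.
    case: eqP => [iq|_]; last by rewrite mulr0.
    by case: kpq; rewrite -ip -iq -PoszD subnKC // -ltnS ltn_ord.
  apply: eq_bigr => i _ /=; rewrite !coef_rees_comp.
  case: eqP => [ip|_]; last by rewrite !mul0r.
  suff -> : (k - i)%:Z = q by rewrite eqxx.
  have ik : (i <= k)%N by rewrite -ltnS ltn_ord.
  by rewrite -(subzn ik) kpq ip addrAC subrr add0r.
Qed.

Lemma gr_homogP p x : gr_homog FL p x <-> gr_comp p x = x.
Proof.
split=> [[a aE <-]|<-].
  rewrite gr_compE; congr gr_class; apply: rees_ext => k.
  by rewrite coef_rees_comp; case: eqP => // /eqP kp; rewrite aE.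
exists (rees_comp p (repr x)) => // i ip.
by rewrite coef_rees_comp (negbTE ip).
Qed.

Lemma gr_class0 : gr_class (0 : rees FL) = 0.
Proof. exact: (raddf0 (\pi_({ideal_quot @rees_ideal L FL}))%qT). Qed.

Lemma gr_comp_neg p x : p < 0 -> gr_comp p x = 0.
Proof.
move=> p0; rewrite /gr_comp -gr_class0; congr gr_class; apply: rees_ext => k.
by rewrite coef_rees_comp coef0; case: eqP => // kp; rewrite -kp in p0.
Qed.

Lemma gr_comp1 : gr_comp 0 1 = 1.
Proof.
rewrite [1]/(gr_class 1) gr_compE; congr gr_class; apply: rees_ext => k.
by rewrite coef_rees_comp coef1; case: k.
Qed.

End GrGrading.

Section GrmGrading.
Variables (L : nzRingType) (FL : ring_filtration L).
Variables (M : lmodType L) (FM : mod_filtration FL M).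
Local Notation R := (gr FL).
Local Notation X := (grm FM).

Definition mrees_single_fun p (w : M) (q : int) : M := if q == p then w else 0.

Fact mrees_single_subproof p w : mfil FM p w -> mrees_pred FM (mrees_single_fun p w).
Proof.
move=> pw; apply/asboolP; split=> [|q]; rewrite /mrees_single_fun.
  apply: (@sub_finite_set _ _ [set p]) => // q /=.
  by case: (q =P p) => // _; rewrite eqxx.
by case: eqP => [->|_] //; exact: mfil0.
Qed.

Definition mrees_single p w (pw : mfil FM p w) : mrees FM :=
  Sub _ (mrees_single_subproof pw).

Definition mrees_comp p (u : mrees FM) : mrees FM := mrees_single (mreesP u p).

Lemma mrees_singleE p w (pw : mfil FM p w) q :
  val (mrees_single pw) q = if q == p then w else 0.
Proof. by []. Qed.

Lemma mrees_compE p u q : val (mrees_comp p u) q = if q == p then val u q else 0.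
Proof. by rewrite mrees_singleE; case: eqP => [->|]. Qed.

Lemma mrees_ext (u v : mrees FM) : (forall q, val u q = val v q) -> u = v.
Proof. by move=> uv; apply/val_inj/funext. Qed.

Lemma mrees_addE (u v : mrees FM) q : val (u + v) q = val u q + val v q.
Proof. by []. Qed.

Lemma mrees_actE (a : rees FL) (u : mrees FM) q :
  val (mrees_act a u) q = \sum_(i < size (val a)) (val a)`_i *: val u (q - i%:Z).
Proof. by []. Qed.

Definition grm_comp p (x : X) : X := grm_class (mrees_comp p (repr x)).

Lemma grm_compE p u : grm_comp p (grm_class u) = grm_class (mrees_comp p u).
Proof.
apply/eqP; rewrite grm_class_eq; apply/asboolP => q.
have /asboolP/(_ q) := grm_repr_class u.
rewrite -[val (mrees_comp p _ - mrees_comp p u) q]/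
  (val (mrees_comp p _) q - val (mrees_comp p u) q).
rewrite !mrees_compE; case: eqP => // _ _.
by rewrite subrr; exact: mfil0.
Qed.

Lemma grm_class_sum I (t : seq I) (F : I -> mrees FM) :
  grm_class (\sum_(i <- t) F i) = \sum_(i <- t) grm_class (F i).
Proof. exact: (raddf_sum (\pi_({ideal_quot @mrees_sub L FL M FM}))%qT). Qed.

Lemma grm_class0 : grm_class (0 : mrees FM) = 0.
Proof. exact: (raddf0 (\pi_({ideal_quot @mrees_sub L FL M FM}))%qT). Qed.

Lemma mrees_sumE I (t : seq I) (F : I -> mrees FM) q :
  val (\sum_(i <- t) F i) q = \sum_(i <- t) val (F i) q.
Proof. by elim/big_rec2: _ => // i y1 y2 _ <-; rewrite mrees_addE. Qed.

Lemma grm_grading : grading (gr_comp (FL := FL)) grm_comp.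
Proof.
split=> [p x y|y|p q y|p q a y].
- rewrite -[x]grm_class_repr -[y]grm_class_repr -grm_classD !grm_compE -grm_classD.
  congr grm_class; apply: mrees_ext => k.
  by rewrite mrees_addE !mrees_compE mrees_addE; case: eqP; rewrite ?addr0.
- set u := repr y; have /asboolP[/finite_seqP[s sE] _] := valP u.
  exists s => t tu st.
  rewrite -[LHS]grm_class_repr -grm_class_sum; congr grm_class; apply: mrees_ext => k.
  rewrite mrees_sumE; under eq_bigr => p _ do rewrite mrees_compE.
  have [kt|kt] := boolP (k \in t).
    rewrite (bigD1_seq k) //= eqxx big1 ?addr0 // => p pk.
    by rewrite eq_sym (negbTE pk).
  rewrite big1_seq => [|p /andP[_ pt]]; last by case: eqP => // kp; rewrite kp pt in kt.
  apply/eqP; apply: contraNT kt => uk; apply: st.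
  by have : [set p | val u p != 0] k by []; rewrite sE.
- rewrite -[y]grm_class_repr !grm_compE.
  have -> : (if p == q then grm_class (mrees_comp p (repr y)) else 0) =
    grm_class (if p == q then mrees_comp p (repr y) else 0).
    by case: eqP => // _; rewrite grm_class0.
  congr grm_class; apply: mrees_ext => k; rewrite !mrees_compE.
  case: (p =P q) => [<-|pq]; rewrite ?mrees_compE; first by case: eqP.
  by case: eqP => // ->; case: eqP.
- rewrite -[_ *: _]/(grm_scale _ _) -[RHS]/(grm_scale _ _).
  rewrite -[a]gr_class_repr -[y]grm_class_repr gr_compE [grm_comp q _]grm_compE.
  rewrite !grm_scaleE grm_compE.
  congr grm_class; apply: mrees_ext => k; rewrite mrees_compE !mrees_actE.
  case: eqP => [kpq|kpq].
    apply: eq_bigr => i _; rewrite mrees_compE coef_rees_comp.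
    case: eqP => [ip|_]; last by rewrite !scale0r.
    by rewrite ip kpq addrAC subrr add0r eqxx.
  rewrite big1 // => i _; rewrite mrees_compE coef_rees_comp.
  case: eqP => [ip|_]; last by rewrite scale0r.
  case: eqP => [iq|_]; last by rewrite scaler0.
  by case: kpq; rewrite -ip -iq addrC subrK.
Qed.

Lemma grm_comp_single p w (pw : mfil FM p w) :
  grm_comp p (grm_class (mrees_single pw)) = grm_class (mrees_single pw).
Proof.
rewrite grm_compE; congr grm_class; apply: mrees_ext => q.
by rewrite mrees_compE mrees_singleE; case: eqP.
Qed.

Fact rees_mono_subproof n (a : L) : rfil FL n%:Z a -> rees_pred FL (a *: 'X^n).
Proof.
move=> na; apply/asboolP => k; rewrite coefZ coefXn; case: eqP => [->|_].
  by rewrite mulr1.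
by rewrite mulr0; exact: rfil0.
Qed.

(** For p >= 0 the coefficient [c] is the symbol of [a], the class of the monomial with coefficient
    [a] in degree p. *)
Lemma grm_single_scale p q a w (aw : mfil FM (p + q) (a *: w)) (qw : mfil FM q w) :
  rfil FL p a -> exists c : R,
  grm_class (mrees_single aw) = c *: grm_class (mrees_single qw).
Proof.
case: p aw => [n|n] aw pa; last first.
  (* For p < 0 the filtration of the ring is zero, so a = 0. *)
  exists 0; rewrite scale0r -grm_class0; congr grm_class; apply: mrees_ext => k.
  by rewrite mrees_singleE (_ : a = 0) // scale0r; case: eqP.
exists (gr_class (Sub _ (rees_mono_subproof pa) : rees FL)).
rewrite -[RHS]/(grm_scale _ _) grm_scaleE; congr grm_class; apply: mrees_ext => k.
rewrite mrees_singleE -[RHS]/(mrees_act_fun (a *: 'X^n) (val (mrees_single qw)) k).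
rewrite (@mrees_act_widen L M n.+1); last first.
  by apply: leq_trans (size_scale_leq _ _) _; rewrite size_polyXn.
rewrite big_ord_recr /= big1 ?add0r => [|i _].
  rewrite coefZ coefXn eqxx mulr1 /mrees_single_fun.
  by rewrite subr_eq addrC; case: eqP; rewrite ?scaler0.
by rewrite coefZ coefXn (ltn_eqF (ltn_ord i)) mulr0 scale0r.
Qed.

Lemma rfil_le_one (p : int) : 0 <= p -> rfil FL p 1.
Proof.
case: p => // n _; elim: n => [|n IH]; first exact: rfil_one.
exact: (rfil_incr IH).
Qed.

(** The symbols of the m_k, placed in degrees p_k, generate: an element of F_q is a sum of a_k m_k
    with a_k in F_(q - p_k), and every product is taken in degree q. *)
Lemma good_filtration_gen : good_filtration FM ->
  exists n (e : 'I_n -> int) (x : 'I_n -> X),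
    (forall k, grm_comp (e k) (x k) = x k) /\ forall z, exists v, comb x v = z.
Proof.
move=> [r [pk [mk FE]]].
have mkP k : mfil FM (pk k) (mk k).
  rewrite FE; exists (fun j => if j == k then 1 else 0) => [j|].
    by case: eqP => [->|_]; [rewrite subrr; exact: rfil_le_one|exact: rfil0].
  rewrite (bigD1 k) //= eqxx scale1r big1 ?addr0 // => j /negbTE ->.
  by rewrite scale0r.
pose x k := grm_class (mrees_single (mkP k)).
exists r, pk, x; split=> [k|z]; first exact: grm_comp_single.
have [_ gS _ _] := grm_grading; have [s sE] := gS z.
have [Z0 ZD ZZ] := range_submodule (mklin (comb_linear x)).
rewrite (sE (undup s)) ?undup_uniq // => [|p ps]; last by rewrite mem_undup.
apply: (big_ind [set z | exists v, comb x v = z]) => // q _.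
rewrite /grm_comp /mrees_comp; set w := val (repr z) q; move: (mreesP _ _) => qw.
have : [set x | exists2 a : 'I_r -> L, forall k, rfil FL (q - pk k) (a k) &
                 x = \sum_(k < r) a k *: mk k] w by rewrite -FE.
move=> [a aP wE].
have akP k : mfil FM ((q - pk k) + pk k) (a k *: mk k) by exact: mfil_scale.
have /choice[c cE] k := grm_single_scale (akP k) (mkP k) (aP k).
exists (\row_k c k); rewrite /comb; under eq_bigr => k _ do rewrite mxE -cE.
rewrite -grm_class_sum; congr grm_class; apply: mrees_ext => j.
rewrite mrees_sumE mrees_singleE wE.
under eq_bigr => k _ do rewrite mrees_singleE subrK.
by case: eqP => // _; rewrite big1.
Qed.

(** The filtration is zero far down, so a nonzero [w] lies in some F_q but not in F_(q-1); its
    symbol in degree q is nonzero. *)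
Lemma grm_homog_nonzero : (exists x : M, x != 0) ->
  exists p (x : X), grm_comp p x = x /\ x <> 0.
Proof.
move=> [w w0]; have [p pw] := mfil_exhaustive FM w.
have [N NE] := mfil_bounded FM.
have [q [qw nqw]] : exists q, mfil FM q w /\ ~ mfil FM (q - 1) w.
  apply: contrapT => nq.
  have all k : mfil FM (p - k%:Z) w.
    elim: k => [|k IH]; first by rewrite subr0.
    apply: contrapT => nk; apply: nq; exists (p - k%:Z); split=> //.
    by rewrite -addrA -opprD -PoszD addn1.
  have [k [Nk kw]] : exists k, (N <= k)%N /\ mfil FM (- k%:Z) w.
    case: p {pw nq} all => n all.
      by exists N; have := all (n + N)%N; rewrite PoszD opprD addrA subrr sub0r.
    by exists (n.+1 + N)%N; have := all N; rewrite leq_addl NegzE -opprD -PoszD.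
  by move: kw w0; rewrite NE // => ->; rewrite eqxx.
exists q, (grm_class (mrees_single qw)); split; first exact: grm_comp_single.
move/eqP; rewrite -grm_class0 grm_class_eq subr0 => /asboolP/(_ q).
by rewrite mrees_singleE eqxx.
Qed.

End GrmGrading.

(** * The formula for gr M and its transfer to M *)

Lemma Gdim_finite (R : pzRingType) (X : lmodType R) : Gdim X <> +oo%E ->
  exists n, [/\ Gdim X = n%:E, Gdim_le X n & forall j, Gdim_le X j -> (n <= j)%N].
Proof.
rewrite /Gdim; case: xgetP => [_ -> [n [Xn nmin] <-] _|//].
by exists n.
Qed.

Theorem proposition2p6 (L : nzRingType) (FL : ring_filtration L)
    (grC : forall x y : gr FL, x * y = y * x)
    (grN : noetherian (gr FL))
    (m : set (gr FL)) (grL : star_local (gr_homog FL) m)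
    (grP : condition_P (gr_homog FL) m)
    (M : lmodType L) (M0 : exists x : M, x != 0)
    (FM : mod_filtration FL M) (FMgood : good_filtration FM)
    (Gfin : Gdim (grm FM) <> +oo%E)
    (Geq : Gdim M = Gdim (grm FM)) :
  (Gdim M + depth (grm FM) m = depth (gr FL)^o m)%E.
Proof.
have rG := gr_grading FL; have xG := grm_grading FM; have hE := @gr_homogP L FL.
have mid := star_local_ideal grL; have m1 := star_local_proper grL.
have mmax := star_local_maximal rG hE grL (@gr_comp_neg L FL) (gr_comp1 FL).
have mtop := star_local_top grN rG hE grL.
have msub : @submodule (gr FL) (gr FL)^o m by [].
have [kappa [u [u_surj uE]]] := quotient_exists msub.
have fgR : fin_gen (gr FL)^o := fin_gen_regular _.
have [P Pproj] := projective_resolution_exists grN (fin_gen_surj u_surj fgR).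
have kgen (x : kappa) : exists a, a *: u 1 = x.
  have [a <-] := u_surj x; exists a; rewrite -linearZ; congr (u _); exact: mulr1.
have kann a : a *: u 1 = 0 <-> m a.
  rewrite -linearZ; apply: iff_trans (uE _) _; by rewrite [_ *: _]mulr1.
have [d d0 d1] := coh_nonzero_exists grC grN mid kgen kann Pproj m1.
have depthE := depth_coh grC grN mid kgen kann Pproj.
rewrite (depthE _ _ fgR d0 d1) Geq.
have [r [e [x [xe xX]]]] := good_filtration_gen FMgood.
have fgX : fin_gen (grm FM) by apply/fin_genP; exists r, x.
(* G-dimension zero is separate: no Ext group is available there, and the input is that X does not
   vanish at m. *)
have [[|n] [-> Xn nmin]] := Gdim_finite Gfin.
  rewrite (depthE _ d) ?add0e //; first exact: (Gdim_zero_coh grC grN mid kgen kann Pproj d0).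
  apply: (Gdim_zero_coh_nonzero grC grN mid m1 mmax kgen kann Pproj d0 d1 Xn).
  (* The annihilator of a nonzero homogeneous element is a proper graded ideal, hence contained in
     m. *)
  have [p [x0 [x0p x00]]] := grm_homog_nonzero FM M0; exists x0 => a ma ax0; apply: ma.
  apply: (mtop [set b | b *: x0 = 0]) => //.
  - split=> [|b c /= bx cx|b c /= cx]; first exact: scale0r.
      by rewrite scalerDl bx cx addr0.
    by rewrite -scalerA cx scaler0.
  - move=> q b /= bx; have := grading_scale_homog rG xG (q + p) b x0p.
    by rewrite bx (grading0 xG) addrK.
  - by rewrite /= scale1r.
have [dd [ee [A [y [homA y0 AS yX]]]]] := graded_resolution grN rG xG xe xX.
pose Q := mxres yX y0 AS; have Qproj k : projective (Q k) by exact: mxres_projective.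
have /Gdim_leP XG := Xn.
(* If Ext^(n+1)(X, R) vanished at m, it would vanish, and the G-resolution could be shortened,
   against minimality. *)
have [tors|nd HX nX] := Gres_coh grC grN mid m1 mmax kgen kann Pproj d0 d1 Qproj XG.
  have Qcoh := graded_coh_torsion grC rG mtop homA tors.
  have /Gdim_leP/nmin := Gres_coh_zero grC grN Qproj XG Qcoh.
  by rewrite ltnn.
rewrite (depthE _ _ fgX HX nX); exact: (congr1 EFin (subnKC nd)).
Qed.
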